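(* There is an absolute constant $c$ such that for all oriented trees $S$ and $T$, $$\mathrm{R}(S,T)\le c(|S|+|T|).$$
   Context: An oriented tree is a directed graph without loops or bidirected edges whose underlying graph is a tree; $|T|$ is its number of vertices. $\mathrm{R}(G_1,G_2)$ is the least $N$ such that every red/blue colouring of the edges of the complete directed graph $\overleftrightarrow{K}_N$ (edge $xy$ for every ordered pair of distinct vertices, so $xy$ and $yx$ may have different colours) contains a red copy of $G_1$ or a blue copy of $G_2$. *)

(* Defs.v *)
From mathcomp Require Import all_boot.
Set Implicit Arguments. Unset Strict Implicit. Unset Printing Implicit Defensive.

Definition undirected (V : finType) (e : rel V) : rel V :=
  fun x y => e x y || e y x.

Definition ug_connected (V : finType) (e : rel V) : Prop :=
  forall x y : V, connect (undirected e) x y.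

Definition ug_acyclic (V : finType) (e : rel V) : Prop :=
  forall s : seq V, uniq s -> 2 < size s -> ~~ cycle (undirected e) s.

Definition oriented_tree (V : finType) (e : rel V) : Prop :=
  [/\ 0 < #|V|,
      (forall x, ~~ e x x),
      (forall x y, e x y -> ~~ e y x),
      ug_connected e & ug_acyclic e].

(* A red/blue colouring of the complete directed graph on N vertices:
   col x y = true means the edge xy is red, false means blue.
   (Values on the diagonal are irrelevant.) *)
Definition colouring (N : nat) := 'I_N -> 'I_N -> bool.

Definition mono_copy (N : nat) (col : colouring N) (b : bool)
  (V : finType) (e : rel V) : Prop :=
  exists f : V -> 'I_N, injective f /\
    forall x y, e x y -> col (f x) (f y) = b.

Definition ramsey_prop (V1 V2 : finType) (e1 : rel V1) (e2 : rel V2)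
  (N : nat) : Prop :=
  forall col : colouring N, mono_copy col true e1 \/ mono_copy col false e2.

(* R(G1,G2) <= M  iff  the least N with ramsey_prop is <= M
   iff some N <= M has ramsey_prop. *)
Definition ramsey_le (V1 V2 : finType) (e1 : rel V1) (e2 : rel V2)
  (M : nat) : Prop :=
  exists2 N, N <= M & ramsey_prop e1 e2 N.

(* Main.v *)
(* Read the colouring as a digraph [D] of blue edges whose [dual] consists of the
   reversed red edges.  Write [unum D X] for the largest [m] such that [X] contains
   all oriented trees with at most [m] vertices; one shows by induction on [#|X|]
   that [#|X| <= c (unum D X + unum (dual D) X)].

   If [dual D] has no subset of large minimum degree, then a linear part of [X]
   splits into consecutive layers between which almost all forward edges are in
   [D].  Three such layers whose subsets contain long [D]-paths contain every
   oriented path, and [2 q + 3] layers allow an embedding of a large tree along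
   its heavy paths, the light subtrees being embedded in the outer layers, until
   only trees smaller by a factor [2 ^ q] are left ([universal_of_small_trees]).
   Applied to [D] and to [dual D] at two scales this is the induction step,
   provided that linear subsets contain long directed paths in both colours, that
   is, provided that the theorem holds for a path against trees.

   That case and the case of two paths rest on [size_bound], which improves the
   coefficient of the longest path from an inductive [be] to an absolute constant.
   A set without dense part in [dual D] is layered, and then either [be + 1]
   short disjoint [D]-paths lead from its last layer back to its first one, and
   winding through the middle layer along them gives a path of linear length, or
   breadth-first search yields a partition, after deletion of few vertices, with
   no edge of [D] from one side to the other.  Iterating the partition gives a
   chain of pieces, along which any functional such as [unum (dual D)] is
   superadditive.  The longest paths of the pieces are compared with a longest
   path of the whole through labels counting forward paths: a sequence in which
   labels are far from increasing contains complete bipartite pieces of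
   [dual D]. *)
Require Import Defs.
From Stdlib Require Import Classical ClassicalEpsilon FunctionalExtensionality.
From mathcomp Require Import all_boot zify.
Set Implicit Arguments. Unset Strict Implicit. Unset Printing Implicit Defensive.

(** * Digraphs and layers *)

Section Digraphs.
Variable V : finType.
Implicit Types (D : rel V) (X Y Z : {set V}) (s : seq V).

(** With the reversal both digraphs point the same way along an order: if [D] has no edge from a
    later set back to an earlier one, then [dual D] is complete from the earlier to the later. *)
Definition dual D : rel V := fun x y => ~~ D y x.

Definition dedge D (d : bool) (x y : V) := if d then D x y else D y x.

(** Loops are counted, since the diagonal of a colouring is arbitrary. The greedy arguments tolerate
    this because the current vertex is always among the forbidden ones. *)
Definition dense D t Y :=
  (Y != set0) &&
  [forall y in Y, (t <= #|[set x in Y | D y x]|) && (t <= #|[set x in Y | D x y]|)].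

Definition haspath D X m :=
  [exists t : m.-tuple V, [&& uniq t, sorted D t & all (mem X) t]].

Lemma cardsU_le X Y : #|X :|: Y| <= #|X| + #|Y|.
Proof. by rewrite cardsU leq_subr. Qed.

Lemma haspathP D X m :
  reflect (exists s, [/\ size s = m, uniq s, sorted D s & {subset s <= X}])
          (haspath D X m).
Proof.
apply: (iffP existsP) => [[t /and3P[tu ts /allP tX]]|[s [sz su ss sX]]].
  by exists t; split => //; rewrite size_tuple.
have sz' : size s == m by apply/eqP.
by exists (Tuple sz'); apply/and3P; split => //; apply/allP.
Qed.

Lemma haspath_le D X m m' : m' <= m -> haspath D X m -> haspath D X m'.
Proof.
move=> le_m /haspathP[s [sz su ss sX]]; apply/haspathP.
exists (take m' s); split.
- by rewrite size_take_min sz; lia.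
- exact: take_uniq.
- exact: take_sorted.
- by move=> x /mem_take /sX.
Qed.

Lemma haspath_card D X m : haspath D X m -> m <= #|X|.
Proof.
case/haspathP=> s [<- su _ sX]; rewrite -(card_uniqP su).
by apply/subset_leq_card/subsetP.
Qed.

Definition pl D X := \max_(m < #|V|.+1 | haspath D X m) m.

Lemma haspath0 D X : haspath D X 0.
Proof. by apply/haspathP; exists [::]; split. Qed.

Lemma pl_ge D X m : haspath D X m -> m <= pl D X.
Proof.
move=> h; have lt : m < #|V|.+1 by rewrite ltnS (leq_trans (haspath_card h)) ?max_card.
exact: (@leq_bigmax_cond _ _ (fun i : 'I_#|V|.+1 => val i) (Ordinal lt)).
Qed.

Lemma plP D X : haspath D X (pl D X).
Proof.
have h0 : #|[pred i : 'I_#|V|.+1 | haspath D X i]| > 0.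
  by apply/card_gt0P; exists ord0; rewrite inE haspath0.
by have [i hi] := eq_bigmax_cond (fun i : 'I_#|V|.+1 => val i) h0; rewrite /pl => ->.
Qed.

Lemma pl_path D X m : m <= pl D X ->
  exists s, [/\ size s = m, uniq s, sorted D s & {subset s <= X}].
Proof. by move=> le_m; apply/haspathP/(haspath_le le_m)/plP. Qed.

Lemma pl_geP D X s : uniq s -> sorted D s -> {subset s <= X} -> size s <= pl D X.
Proof. by move=> su ss sX; apply: pl_ge; apply/haspathP; exists s. Qed.

Lemma pl_mono D X Y : X \subset Y -> pl D X <= pl D Y.
Proof.
move=> /subsetP XY; have [s [<- su ss sX]] := pl_path (leqnn (pl D X)).
by apply: pl_geP => // x /sX/XY.
Qed.

Lemma pl_pos D X x : x \in X -> 0 < pl D X.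
Proof.
by move=> xX; apply: (@pl_geP D X [:: x]) => // y; rewrite inE => /eqP->.
Qed.

Lemma dense_pl D t Y : dense D t Y -> t <= pl D Y.
Proof.
case/andP=> /set0Pn[y0 y0Y] /forall_inP dn.
suff: exists s, [/\ size s = t, uniq s, sorted D s & {subset s <= Y}].
  by case=> s [<- *]; apply: pl_geP.
suff H k : k <= t -> 0 < k -> exists s, [/\ size s = k, uniq s, sorted D s & {subset s <= Y}].
  by case: t {dn} H => [|t] H; [exists [::]; split | apply: H].
elim: k => // -[_ _ _|k IH kt _].
  by exists [:: y0]; split => // y; rewrite inE => /eqP->.
have [s [sz su ss sY]] := IH (ltnW kt) isT.
case/lastP: s sz su ss sY => [|s y] sz su ss sY; first by [].
have yY : y \in Y by apply: sY; rewrite mem_rcons mem_head.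
have /andP[dy _] := dn _ yY.
have [w] : exists w, w \in [set x in Y | D y x] :\: [set x in rcons s y].
  apply/set0Pn; rewrite -card_gt0 cardsD subn_gt0.
  apply: leq_ltn_trans (leq_trans _ dy); last exact: kt.
  apply: leq_trans (subset_leq_card (subsetIr _ _)) _.
  by rewrite cardsE -sz card_size.
rewrite !inE => /andP[ws /andP[wY Dyw]].
exists (rcons (rcons s y) w); split.
- by rewrite size_rcons sz.
- by rewrite rcons_uniq ws.
- by move: ss; case: (s) => [|a s'] /=; rewrite ?Dyw // !rcons_path last_rcons => /andP[-> ->].
- by move=> z; rewrite mem_rcons inE => /predU1P[->|/sY].
Qed.

(** Degeneracy ordering: a vertex with fewer than [t] out-neighbours in [dual D] is split off and
    put last, one with fewer than [t] in-neighbours first. Each removal creates fewer than [t]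
    forward non-edges of [D]. *)
Lemma peel D t X : (forall Y, Y \subset X -> ~~ dense (dual D) t Y) ->
  exists pos : V -> nat, {in X &, injective pos} /\
    \sum_(x in X) #|[set z in X | (pos x < pos z) && ~~ D x z]| <= t * #|X|.
Proof.
have [k] := ubnP #|X|; elim: k X => // k IH X; rewrite ltnS => Xk ndX.
have [->|X0] := eqVneq X set0.
  by exists (fun=> 0); split; [move=> x y; rewrite inE | rewrite big_set0].
have: exists2 y, y \in X & (#|[set x in X | ~~ D x y]| < t) || (#|[set x in X | ~~ D y x]| < t).
  have := ndX X (subxx X); rewrite /dense X0 /= => /forall_inPn[y yX].
  by rewrite negb_and -!ltnNge => h; exists y.
case=> y yX ylow.
have cX : #|X| = #|X :\ y|.+1 by rewrite (cardsD1 y X) yX.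
have [||pos [inj sle]] := IH (X :\ y); first by lia.
  by move=> Y YX; apply: ndX; apply: subset_trans YX (subsetDl _ _).
case/orP: ylow => ylow.
- set M := \max_(x in X) pos x.
  pose pos' z := if z == y then M.+1 else pos z.
  have leM z : z \in X -> pos z <= M by move=> zX; apply: leq_bigmax_cond.
  exists pos'; split.
    move=> a b aX bX; rewrite /pos'; case: eqVneq => [->|ay]; case: eqVneq => [->|b_y] //.
    + by move=> h; have := leM _ bX; rewrite -h ltnn.
    + by move=> h; have := leM _ aX; rewrite h ltnn.
    + by apply: inj; rewrite !inE ?ay ?b_y.
  rewrite (big_setD1 y) //=.
  have -> : #|[set z in X | (pos' y < pos' z) && ~~ D y z]| = 0.
    apply/eqP; rewrite cards_eq0; apply/eqP/setP => z; rewrite !inE /pos' eqxx.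
    case: eqVneq => [_|zy]; first by rewrite ltnn andbF.
    by apply/negP => /andP[zX /andP[h _]]; have := leM _ zX; lia.
  rewrite add0n.
  have step x : x \in X :\ y ->
     #|[set z in X | (pos' x < pos' z) && ~~ D x z]| <=
     #|[set z in X :\ y | (pos x < pos z) && ~~ D x z]| + ~~ D x y.
    rewrite !inE => /andP[xy xX].
    have sub : [set z in X | (pos' x < pos' z) && ~~ D x z] \subset
      [set z in X :\ y | (pos x < pos z) && ~~ D x z] :|: (if ~~ D x y then [set y] else set0).
      apply/subsetP=> z; rewrite !inE /pos' (negPf xy).
      case: (eqVneq z y) => [->|zy]; first by case/and3P=> _ _ ->; rewrite inE eqxx orbT.
      by case/and3P=> -> -> ->.
    apply: leq_trans (subset_leq_card sub) _; apply: leq_trans (cardsU_le _ _) _.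
    by rewrite leq_add2l; case: (~~ D x y); rewrite ?cards1 ?cards0.
  apply: (@leq_trans (\sum_(x in X :\ y)
     (#|[set z in X :\ y | (pos x < pos z) && ~~ D x z]| + ~~ D x y))).
    exact: leq_sum.
  rewrite big_split /= cX mulnS addnC.
  apply: leq_add sle; apply: leq_trans (ltnW ylow).
  rewrite -big_mkcondr sum1_card; apply: subset_leq_card; apply/subsetP => x.
  by rewrite unfold_in /= !inE => /andP[/andP[_ ->] ->].
- pose pos' z := if z == y then 0 else (pos z).+1.
  exists pos'; split.
    move=> a b aX bX; rewrite /pos'; case: eqVneq => [->|ay]; case: eqVneq => [->|b_y] //.
    by case; apply: inj; rewrite !inE ?ay ?b_y.
  rewrite (big_setD1 y) //= cX mulnS; apply: leq_add.
    apply: leq_trans (ltnW ylow); apply: subset_leq_card; apply/subsetP => x.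
    by rewrite !inE => /and3P[-> _ ->].
  apply: leq_trans sle; apply: leq_sum => x; rewrite !inE => /andP[xy xX].
  apply: subset_leq_card; apply/subsetP => z; rewrite !inE /pos' (negPf xy).
  by case: (eqVneq z y) => [->|zy] /=; [rewrite andbF | rewrite ltnS].
Qed.

Lemma sum_card_swap (P : rel V) X :
  \sum_(x in X) #|[set z in X | P x z]| = \sum_(x in X) #|[set z in X | P z x]|.
Proof.
have H (Q : rel V) x : #|[set z in X | Q x z]| = \sum_(z in X) Q x z.
  by rewrite -sum1_card big_mkcond [RHS]big_mkcond; apply: eq_bigr => z _; rewrite !inE; do 2!case: ifP => //; case: (Q x z) => // -> .
under eq_bigr do rewrite H.
rewrite exchange_big /=; apply: eq_bigr => x _; by rewrite (H (fun a b => P b a)).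
Qed.

Definition layered D e L (B : nat -> {set V}) :=
  forall i j, i < j -> j < L ->
    [/\ [disjoint B i & B j],
        forall x, x \in B i -> #|[set z in B j | ~~ D x z]| <= e &
        forall z, z \in B j -> #|[set x in B i | ~~ D x z]| <= e].

(** By Markov's inequality at least half of [X] lies on at most [4 * t] forward non-edges; these
    vertices, sorted by [pos], are cut into consecutive windows of width [w]. *)
Lemma layers D t X L w :
  (forall Y, Y \subset X -> ~~ dense (dual D) t Y) -> 2 * (L * w) <= #|X| ->
  exists B : nat -> {set V},
    (forall i, i < L -> B i \subset X /\ #|B i| = w) /\ layered D (4 * t) L B.
Proof.
move=> nd szX; have [pos [inj sle]] := peel nd.
pose a x := [set z in X | (pos x < pos z) && ~~ D x z].
pose b x := [set z in X | (pos z < pos x) && ~~ D z x].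
have sb : \sum_(x in X) #|b x| <= t * #|X|.
  by rewrite -(sum_card_swap (fun x z => (pos x < pos z) && ~~ D x z)).
pose X' := [set x in X | #|a x| + #|b x| <= 4 * t].
have X'X : X' \subset X by apply/subsetP => x; rewrite inE => /andP[].
have cX' : #|X| <= 2 * #|X'|.
  have bad : #|X :\: X'| * (4 * t).+1 <= 2 * (t * #|X|).
    rewrite mul2n -addnn; apply: leq_trans (leq_add sle sb).
    rewrite -big_split /= -sum_nat_const.
    rewrite [X in _ <= X](big_setID X') /= (setIidPr X'X).
    apply: leq_trans (leq_addl _ _); apply: leq_sum => x.
    by rewrite !inE => /andP[h xX]; move: h; rewrite xX /= -ltnNge.
  have := cardsID X' X; rewrite (setIidPr X'X); nia.
pose s := sort (fun x y => pos x <= pos y) (enum X').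
have memS x : (x \in s) = (x \in X') by rewrite mem_sort mem_enum.
have us : uniq s by rewrite sort_uniq enum_uniq.
have szs : size s = #|X'| by rewrite size_sort -cardE.
have srt : sorted (fun x y => pos x < pos y) s.
  have s1 : sorted (fun x y => pos x <= pos y) s by apply: sort_sorted => x y; apply: leq_total.
  have tr : transitive (fun x y : V => pos x <= pos y) by move=> y x z; apply: leq_trans.
  rewrite sorted_pairwise; last by move=> y x z; apply: ltn_trans.
  move: s1; rewrite sorted_pairwise // => s1.
  have : pairwise (fun x y => x != y) s by rewrite -uniq_pairwise.
  have: {subset s <= X} by move=> x; rewrite memS => /(subsetP X'X).
  elim: (s) s1 => //= x s' IH /andP[ax ps] sX /andP[nx pn]; apply/andP; split; last first.
    by apply: IH => // y ys; apply: sX; rewrite inE ys orbT.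
  apply/allP => y ys; rewrite ltn_neqAle (allP ax) // andbT.
  apply: contra (allP nx _ ys) => /eqP /inj e; apply/eqP/e; apply: sX; rewrite inE ?eqxx ?ys ?orbT //.
clearbody s.
pose B i : {set V} := [set x in take w (drop (i * w) s)].
have BP i x : x \in B i -> exists k, [/\ i * w <= k, k < i.+1 * w, k < size s & x = nth x s k].
  rewrite inE => /(nthP x)[k]; rewrite size_take_min size_drop => h e.
  move: h; rewrite leq_min => /andP[h1 h2].
  exists (i * w + k); split; [by rewrite leq_addr|by rewrite mulSn addnC ltn_add2r|
    by rewrite -ltn_subRL|by rewrite -nth_drop -(@nth_take w)].
have lts i j x z : i < j -> x \in B i -> z \in B j -> pos x < pos z.
  move=> ij /BP[k [k1 k2 k3 ->]] /BP[l [l1 l2 l3 ->]].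
  rewrite (set_nth_default x z) //.
  have tr : transitive (fun x y : V => pos x < pos y) by move=> ? ? ?; apply: ltn_trans.
  by apply: (sorted_ltn_nth tr x srt); rewrite ?inE //; nia.
have BX' i : B i \subset X'.
  by apply/subsetP => x; rewrite inE => /mem_take /mem_drop; rewrite memS.
have exc x : x \in X' -> #|a x| <= 4 * t /\ #|b x| <= 4 * t by rewrite inE => /andP[_]; lia.
exists B; split=> [i iL|i j ij jL].
  split; first exact: subset_trans (BX' i) X'X.
  rewrite cardsE (card_uniqP _) ?take_uniq ?drop_uniq // size_take_min size_drop szs; nia.
split.
- rewrite -setI_eq0; apply/eqP/setP => x; rewrite !inE.
  apply/negP => /andP[x1 x2]; suff: pos x < pos x by rewrite ltnn.
  by apply: lts ij _ _; rewrite inE.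
- move=> x xi; have [h _] := exc _ (subsetP (BX' i) _ xi); apply: leq_trans h.
  apply: subset_leq_card; apply/subsetP => z; rewrite [z \in _]inE => /andP[zj nD].
  by rewrite inE nD (lts _ _ _ _ ij xi zj) (subsetP X'X) // (subsetP (BX' j)).
- move=> z zj; have [_ h] := exc _ (subsetP (BX' j) _ zj); apply: leq_trans h.
  apply: subset_leq_card; apply/subsetP => x; rewrite [x \in _]inE => /andP[xi nD].
  by rewrite inE nD (lts _ _ _ _ ij xi zj) (subsetP X'X) // (subsetP (BX' i)).
Qed.

End Digraphs.

(** * Embeddings of oriented trees *)

(* [Graft d c r] adds to [r] a new edge from its root to the root of [c], directed away
   from the root of [r] if [d] and towards it otherwise; every vertex is a leaf of the
   term, and the root of [r] stays the root. *)
Inductive otree (T : Type) : Type :=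
  | Vertex of T
  | Graft of bool & otree T & otree T.

Fixpoint osize T (t : otree T) :=
  if t is Graft _ c r then osize c + osize r else 1.

Lemma osize_gt0 T (t : otree T) : 0 < osize t.
Proof. by elim: t => //= d c hc r hr; rewrite addn_gt0 hc. Qed.

(** Edge directions along the heavy path from the root, where a child is heavy if its subtree has at
    least [h] vertices. If [osize t < 2 * h], no vertex has two heavy children. *)
Fixpoint spine T h (t : otree T) : seq bool :=
  if t is Graft d c r then if h <= osize c then d :: spine h c else spine h r
  else [::].

Lemma size_spine T h (t : otree T) : (size (spine h t)).+1 <= osize t.
Proof.
elim: t => //= d c hc r hr; case: ifP => _ /=; first by have := osize_gt0 r; lia.
by have := osize_gt0 c; lia.
Qed.

Section Embedding.
Variable V : finType.
Implicit Types (D : rel V) (X Y Z U F : {set V}).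

(** The image [U] is carried along instead of a map, so that injectivity becomes disjointness of the
    images of the two halves. *)
Fixpoint emb T D (t : otree T) (v : V) U : Prop :=
  match t with
  | Vertex _ => U = [set v]
  | Graft d c r => exists w U1 U2,
      [/\ U = U1 :|: U2, [disjoint U1 & U2], dedge D d v w, emb D c w U1 & emb D r v U2]
  end.

Lemma emb_root T D (t : otree T) v U : emb D t v U -> v \in U.
Proof.
elim: t v U => [a|d c _ r IH] v U /=; first by move=> ->; rewrite set11.
by case=> w [U1 [U2 [-> _ _ _ /IH h]]]; rewrite inE h orbT.
Qed.

Lemma emb_card T D (t : otree T) v U : emb D t v U -> #|U| = osize t.
Proof.
elim: t v U => [a|d c IHc r IHr] v U /=; first by move=> ->; rewrite cards1.
case=> w [U1 [U2 [-> dis _ /IHc <- /IHr <-]]].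
by rewrite cardsU (disjoint_setI0 dis) cards0 subn0.
Qed.

Definition universal D X m :=
  forall t : otree nat, osize t <= m -> exists v U, emb D t v U /\ U \subset X.

Lemma universal_le D X m m' : m' <= m -> universal D X m -> universal D X m'.
Proof. by move=> le h t ht; apply: h; apply: leq_trans le. Qed.

Lemma universal_sub D X Y m : X \subset Y -> universal D X m -> universal D Y m.
Proof.
move=> XY h t /h[v [U [e s]]]; exists v, U; split => //; exact: subset_trans XY.
Qed.

Lemma universal0 D X : universal D X 0.
Proof. by move=> t; have := osize_gt0 t; lia. Qed.

Lemma universal1 D X x : x \in X -> universal D X 1.
Proof.
move=> xX [a|d c r] /=; last by have := osize_gt0 c; have := osize_gt0 r; lia.
by move=> _; exists x, [set x]; split=> //; rewrite sub1set.
Qed.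

(** Tested on a star with [m] vertices. *)
Lemma universal_card D X m : universal D X m -> m <= #|X|.
Proof.
move=> h; pose star := iter m.-1 (Graft true (Vertex 0)) (Vertex 0).
have sz : osize star = m.-1.+1 by rewrite /star; elim: (m.-1) => //= k ->.
case: m => // m in h star sz *.
have [|v [U [/emb_card e /subset_leq_card]]] := h star; first by rewrite sz.
by rewrite e sz.
Qed.

(** Greedy embedding: [F] collects the vertices already taken, and the degrees always leave a free
    neighbour. *)
Lemma dense_universal D t Y : dense D t Y -> universal D Y t.
Proof.
case/andP=> /set0Pn[y0 y0Y] /forall_inP dn T hT.
suff H (T' : otree nat) v F : v \in Y -> v \notin F -> #|F| + osize T' <= t ->
    exists U, emb D T' v U /\ U \subset Y :\: F.
  have [||U [e s]] := H T y0 set0 y0Y; rewrite ?inE ?cards0 //.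
  by exists y0, U; split=> //; rewrite setD0 in s.
elim: T' v F {T hT} => [a|d c IHc r IHr] v F vY vF /= sz.
  by exists [set v]; split=> //; rewrite sub1set inE vF.
have sc := osize_gt0 c; have sr := osize_gt0 r.
have [w] : exists w, w \in [set w in Y | dedge D d v w] :\: (v |: F).
  apply/set0Pn; rewrite -card_gt0 cardsD subn_gt0.
  apply: leq_ltn_trans (subset_leq_card (subsetIr _ _)) _.
  rewrite cardsU1 vF; have /andP[d1 d2] := dn _ vY.
  have : t <= #|[set w in Y | dedge D d v w]| by case: (d).
  by lia.
rewrite !inE negb_or => /andP[/andP[wv wF] /andP[wY Dw]].
have [||U1 [e1 s1]] := IHc w (v |: F) wY; rewrite ?inE ?negb_or ?wv //.
  by rewrite cardsU1 vF; lia.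
have /subsetP s1' := s1.
have [||U2 [e2 s2]] := IHr v (F :|: U1) vY.
- rewrite inE (negPf vF) /=; apply/negP => /s1'; by rewrite !inE eqxx.
- rewrite (leq_trans (leq_add (cardsU_le _ _) (leqnn _))) // (emb_card e1); lia.
exists (U1 :|: U2); split.
  exists w, U1, U2; split=> //.
  rewrite disjoint_sym disjoints_subset; apply/subsetP => z /(subsetP s2).
  by rewrite !inE => /andP[]; case: (z \in U1); rewrite ?orbT.
rewrite subUset; apply/andP; split; apply/subsetP => z.
  by move=> /s1'; rewrite !inE negb_or => /andP[/andP[_ ->] ->].
by move=> /(subsetP s2); rewrite !inE negb_or => /andP[/andP[-> _] ->].
Qed.

Fixpoint opath D (v : V) (bs : seq bool) (p : seq V) : bool :=
  match bs, p with
  | [::], [::] => true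
  | b :: bs', w :: p' => dedge D b v w && opath D w bs' p'
  | _, _ => false
  end.

Lemma opath_cat D v bs1 p1 bs2 p2 :
  opath D v bs1 p1 -> opath D (last v p1) bs2 p2 -> opath D v (bs1 ++ bs2) (p1 ++ p2).
Proof. by elim: bs1 v p1 => [|b bs IH] v [|w p] //= /andP[-> h1]; apply: IH. Qed.

Lemma opath_path D v p : path D v p -> opath D v (nseq (size p) true) p.
Proof. by elim: p v => //= w p IH v /andP[-> /IH]. Qed.

Definition conv D : rel V := fun x y => D y x.

Lemma opath_conv D v bs p : opath (conv D) v bs p = opath D v (map negb bs) p.
Proof. by elim: bs v p => [|b bs IH] v [|w p] //=; rewrite IH; case: b. Qed.

End Embedding.

(** * Embedding large trees in layered sets *)

Section PathPatterns.
Variable V : finType.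
Implicit Types (D : rel V) (X Y A M C F : {set V}).

Lemma card_good (P : pred V) C F e n :
  #|[set z in C | ~~ P z]| <= e -> #|F| <= n ->
  #|C| <= e + n + #|[set z in C | P z] :\: F|.
Proof.
move=> he hF.
have sub : C \subset [set z in C | ~~ P z] :|: (F :|: ([set z in C | P z] :\: F)).
  by apply/subsetP => z zC; rewrite !inE zC /=; case: (P z); case: (z \in F).
apply: leq_trans (subset_leq_card sub) _.
apply: leq_trans (cardsU_le _ _) _; rewrite -addnA; apply: leq_add => //.
by apply: leq_trans (cardsU_le _ _) _; rewrite leq_add2r.
Qed.

Lemma haspath_conv D X m : haspath D X m -> haspath (conv D) X m.
Proof.
case/haspathP=> s [sz us ss sX]; apply/haspathP; exists (rev s); split.
- by rewrite size_rev.
- by rewrite rev_uniq.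
- by rewrite rev_sorted.
- by move=> x; rewrite mem_rev => /sX.
Qed.

Definition almost_complete D e A C :=
  (forall x, x \in A -> #|[set z in C | ~~ D x z]| <= e) /\
  (forall z, z \in C -> #|[set x in A | ~~ D x z]| <= e).

Lemma almost_complete_conv D e A C :
  almost_complete D e A C -> almost_complete (conv D) e C A.
Proof. by case. Qed.

Lemma true_run bs : exists r bs', bs = nseq r true ++ bs' /\ ~~ head false bs'.
Proof.
elim: bs => [|[] bs [r [bs' [-> h]]]]; first by exists 0, [::].
  by exists r.+1, bs'.
by exists 0, (false :: nseq r true ++ bs').
Qed.

(* Sources of the pattern go to [A], sinks to [C], and the interior of every
   directed run is a segment of a directed path inside [M]. *)
Lemma zigzag n kappa e k D A M C bs v F :
  size bs <= k ->
  almost_complete D e A M -> almost_complete D e M C -> almost_complete D e A C ->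
  (forall Y, Y \subset M -> kappa <= #|Y| -> haspath D Y n) ->
  e + n + kappa <= #|M| -> e + n < #|A| -> e + n < #|C| ->
  (if bs is b :: _ then v \in (if b then A else C) else true) ->
  v \in F -> #|F| + size bs <= n ->
  exists p, [/\ opath D v bs p, uniq p & {subset p <= (A :|: M :|: C) :\: F}].
Proof.
elim: k D A M C bs v F => [|k IH] D A M C [|b bs] v F //= szk AM MC AC hM cM cA cC vb vF szF;
  try by exists [::].
(* Reversing [D] exchanges [A] and [C], so the pattern may be assumed to start with a forward
   edge. *)
wlog bT : D A M C b bs szk AM MC AC hM cM cA cC vb szF / b = true.
  case: b vb szF => vb szF W; first exact: (W D A M C true).
  have hM' Y : Y \subset M -> kappa <= #|Y| -> haspath (conv D) Y n.
    by move=> YM cY; apply/haspath_conv/hM.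
  have sz' : size (map negb bs) < k.+1 by rewrite size_map.
  have szF' : #|F| + (size (map negb bs)).+1 <= n by rewrite size_map.
  have [p [h1 h2 h3]] := W (conv D) C M A true _ sz' (almost_complete_conv MC)
     (almost_complete_conv AM) (almost_complete_conv AC) hM' cM cC cA vb szF' erefl.
  have ebs : map negb (true :: map negb bs) = false :: bs.
    by rewrite /= -map_comp (eq_map negbK) map_id.
  have h1' : opath D v (false :: bs) p by rewrite -ebs -opath_conv.
  exists p; split=> //.
  move=> x /h3; rewrite !inE => /andP[-> /=].
  by case: (x \in A) (x \in M) (x \in C) => [] [] [].
(* The first run has [r + 1] edges: [r] interior vertices in [M], then [y] in [C]; for [r = 0] the
   edge comes from [AC]. What remains of the pattern is empty or starts backwards from [y]. *)
subst b; have [r [bs' [ebs hbs']]] := true_run bs.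
have szb : size bs = r + size bs' by rewrite ebs size_cat size_nseq.
have cF : #|F| <= n by lia.
have cJ := card_good (AM.1 _ vb) cF.
have /haspathP[p1 [sz1 u1 s1 J1]] : haspath D ([set z in M | D v z] :\: F) r.
  apply: (@haspath_le _ _ _ n); first lia.
  by apply: hM; [apply/subsetP=> z; rewrite !inE => /andP[_ /andP[]] | lia].
have pth1 : path D v p1.
  case: (p1) s1 J1 => //= z s -> J1; have := J1 z (mem_head _ _).
  by rewrite !inE => /and3P[_ _ ->].
have cx : #|[set z in C | ~~ D (last v p1) z]| <= e.
  case/lastP: (p1) J1 => [|s z] J1; first exact: AC.1.
  rewrite last_rcons; apply: MC.1.
  by have := J1 z; rewrite mem_rcons mem_head !inE => /(_ isT) /and3P[].
have cp1 : #|[set z in p1]| = size p1 by rewrite cardsE (card_uniqP u1).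
have cFp : #|F :|: [set z in p1]| <= n.
  by have := cardsU_le F [set z in p1]; lia.
have [y] : exists y, y \in [set z in C | D (last v p1) z] :\: (F :|: [set z in p1]).
  by apply/set0Pn; rewrite -card_gt0; have := card_good cx cFp; lia.
rewrite !inE negb_or => /andP[/andP[yF yp1] /andP[yC Dy]].
have [||||p2 [h1 h2 h3]] := IH D A M C bs' y (y |: (F :|: [set z in p1])) _ AM MC AC hM cM cA cC.
- by lia.
- by case: (bs') hbs' => [//|[]].
- by rewrite setU11.
- have -> : #|y |: (F :|: [set z in p1])| = #|F :|: [set z in p1]|.+1.
    by rewrite cardsU1 !inE (negPf yF) (negPf yp1).
  by have := cardsU_le F [set z in p1]; lia.
have hp : opath D v (true :: bs) (p1 ++ y :: p2).
  have -> : true :: bs = nseq (size p1) true ++ true :: bs'.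
    by rewrite ebs sz1; elim: (r) => //= r' ->.
  by apply: opath_cat; [exact: opath_path | rewrite /= Dy].
exists (p1 ++ y :: p2); split=> //.
- rewrite cat_uniq u1 /= h2 andbT negb_or yp1 /=; apply/andP; split.
    by apply/hasPn => z /h3; rewrite !inE !negb_or => /andP[/and3P[]].
  by apply/negP => /h3; rewrite !inE eqxx.
- move=> z; rewrite mem_cat inE => /or3P[/J1|/eqP->|/h3]; rewrite !inE.
  + by case/and3P=> -> -> _; rewrite !orbT.
  + by rewrite yF yC !orbT.
  + by rewrite !negb_or => /andP[/and3P[_ -> _] ->].
Qed.

(** A vertex misses at most [4 * n] vertices of another layer and at most [n] are already used,
    whence the width [kappa + 5 * n + 1] of the three layers. *)
Lemma oriented_path_in D X n kappa :
  (forall Y, Y \subset X -> ~~ dense (dual D) n Y) ->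
  (forall Y, Y \subset X -> kappa <= #|Y| -> haspath D Y n) ->
  6 * (kappa + 5 * n + 1) <= #|X| ->
  forall bs, size bs < n ->
  exists v p, [/\ opath D v bs p, uniq (v :: p) & {subset v :: p <= X}].
Proof.
move=> nd hX szX bs szb.
have [|B [hB lay]] := @layers _ D n X 3 (kappa + 5 * n + 1) nd; first by lia.
have [_ l01 l01'] := lay 0 1 isT isT; have [_ l12 l12'] := lay 1 2 isT isT.
have [_ l02 l02'] := lay 0 2 isT isT.
have [s0 c0] := hB 0 isT; have [s1 c1] := hB 1 isT; have [s2 c2] := hB 2 isT.
have [v vb] : exists v, v \in (if head true bs then B 0 else B 2).
  by apply/set0Pn; rewrite -card_gt0; case: (head _ _); lia.
have [||||||||||p [h1 h2 h3]] := @zigzag n kappa (4 * n) (size bs) D (B 0) (B 1) (B 2) bs v [set v] (leqnn _);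
  rewrite ?set11 ?cards1 //; try lia.
- by move=> Y YB; apply: hX; apply: subset_trans s1.
- by case: (bs) vb => [|[]].
exists v, p; split=> //=.
  by rewrite h2 andbT; apply/negP => /h3; rewrite !inE eqxx.
move=> x; rewrite inE => /predU1P[->|/h3].
  by move: vb; case: (head _ _) => /(subsetP _ _); apply.
by rewrite !inE -orbA => /andP[_ /or3P[] /(subsetP _ _)]; apply.
Qed.

End PathPatterns.

Section EmbedTree.
Variable V : finType.
Implicit Types (D : rel V) (X Y Z R U F : {set V}).

Lemma spine_light T h (t : otree T) : osize t < h -> spine h t = [::].
Proof.
elim: t => //= d c _ r IH; have := osize_gt0 c => c0 sz.
by rewrite leqNgt (_ : osize c < h) ?IH //; lia.
Qed.

(** With the heavy path placed on [v :: p], the light subtrees are hung into [Z] one after the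
    other. Once a heavy child is split off, the remainder at its parent has fewer than [h] vertices
    and hence an empty spine. *)
Lemma attach D n h R Z :
  [disjoint R & Z] ->
  (forall c : otree nat, osize c < h -> forall x d F, x \in R -> #|F| + osize c <= n ->
     exists w U, [/\ emb D c w U, U \subset Z :\: F & dedge D d x w]) ->
  forall (t : otree nat) v p F, osize t < 2 * h -> {subset v :: p <= R} -> uniq (v :: p) ->
    opath D v (spine h t) p -> #|F| + osize t <= n ->
    exists U, emb D t v U /\ U \subset [set x in v :: p] :|: (Z :\: F).
Proof.
move=> dRZ light; have RZ x : x \in R -> x \in Z = false.
  by move=> xR; apply/negP => xZ; move/pred0P: dRZ => /(_ x) /=; rewrite xR xZ.
elim=> [a|d c IHc r IHr] v p F szt sub up op szF.
  exists [set v]; split=> //; rewrite sub1set !inE eqxx //.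
rewrite /= in szt szF op; have c0 := osize_gt0 c; have r0 := osize_gt0 r.
have vR : v \in R by apply: sub; rewrite mem_head.
case: leqP op => hc op.
  case: p up sub op => //= w p /andP[vp up] sub /andP[Dvw op].
  have [|||U1 [e1 s1]] := IHc w p F _ _ up op; try lia.
    by move=> x xp; apply: sub; rewrite inE xp orbT.
  have [|||||U2 [e2 s2]] := IHr v [::] (F :|: U1); rewrite ?spine_light //; try lia.
  - by move=> x; rewrite inE => /eqP->.
  - by have := cardsU_le F U1; rewrite (emb_card e1); lia.
  have sub2 z : z \in U2 -> z = v \/ (z \in Z /\ z \notin F :|: U1).
    move/(subsetP s2); rewrite !inE => /orP[/eqP->|/andP[zF ->]]; [by left|right].
    by rewrite zF.
  exists (U1 :|: U2); split.
    exists w, U1, U2; split=> //; rewrite -setI_eq0; apply/eqP/setP => z; rewrite !inE.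
    apply/negP => /andP[z1 /sub2[ez|[_]]]; last by rewrite inE z1 orbT.
    move/(subsetP s1): z1; rewrite ez inE => /orP[|].
      by rewrite inE (negPf vp).
    by rewrite inE RZ // andbF.
  rewrite subUset; apply/andP; split; apply/subsetP => z.
    by move/(subsetP s1); rewrite !inE => /orP[->|->]; rewrite ?orbT.
  case/sub2=> [->|[]]; first by rewrite !inE eqxx.
  by rewrite !inE negb_or => -> /andP[-> _]; rewrite orbT.
have [|w [U1 [e1 s1 Dvw]]] := light c hc v d F vR; first lia.
have [||U2 [e2 s2]] := IHr v p (F :|: U1) _ sub up op; try lia.
  by have := cardsU_le F U1; rewrite (emb_card e1); lia.
exists (U1 :|: U2); split.
  exists w, U1, U2; split=> //; rewrite -setI_eq0; apply/eqP/setP => z; rewrite [RHS]inE inE.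
  apply/negP => /andP[z1 /(subsetP s2)]; rewrite inE => /orP[|].
    rewrite inE => /sub zR; move/(subsetP s1): z1; by rewrite inE RZ // andbF.
  by rewrite !inE z1 orbT.
rewrite subUset; apply/andP; split; apply/subsetP => z.
  by move/(subsetP s1); rewrite !inE => ->; rewrite orbT.
by move/(subsetP s2); rewrite !inE negb_or => /orP[->//|/andP[/andP[-> _] ->]]; rewrite orbT.
Qed.

(* Subtrees of size at most [m] live in the two outermost blocks; the vertices
   whose subtree size lies in [2^i (m+1), 2^(i+1) (m+1)) form disjoint paths,
   which are placed [i + 1] blocks further inside, on the side prescribed by
   the orientation of the edge to the parent. *)
Lemma universal_of_small_trees D X n q kappa m w0 W :
  (forall Y, Y \subset X -> ~~ dense (dual D) n Y) ->
  (forall Y, Y \subset X -> kappa <= #|Y| -> haspath D Y n) ->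
  (forall Y, Y \subset X -> w0 <= #|Y| -> universal D Y m) ->
  n < 2 ^ q * m.+1 -> 6 * (kappa + 5 * n + 1) + 5 * n <= W -> w0 + 5 * n <= W ->
  2 * ((2 * q + 3) * W) <= #|X| -> universal D X n.
Proof.
move=> nd hX sX nq cW cW0 szX.
have [B [hB lay]] := layers nd szX.
pose side (d : bool) i := if d then 2 * q + 2 - i else i.
(* Level [i] uses the [i + 1] outermost blocks on either side; block [q + 1] is the middle one. *)
pose zone i := [set x | [exists j : 'I_i.+1, (x \in B j) || (x \in B (2 * q + 2 - j))]].
have zoneX i : i <= q -> zone i \subset X.
  move=> iq; apply/subsetP => x; rewrite inE => /existsP[j /orP[]];
    have ij := ltn_ord j.
    by have [|s _] := hB j; [lia|move/(subsetP s)].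
  by have [|s _] := hB (2 * q + 2 - j); [lia|move/(subsetP s)].
have dis i k x : i < k -> k < 2 * q + 2 - i -> x \in B k -> x \notin zone i.
  move=> ik ki xk; rewrite inE; apply/existsPn => j; have ij := ltn_ord j.
  rewrite negb_or; apply/andP; split; apply/negP => xj.
    have [||/pred0P/(_ x)] := lay j k; try lia; by rewrite /= xj xk.
  have [||/pred0P/(_ x)] := lay k (2 * q + 2 - j); try lia; by rewrite /= xj xk.
have pick i k x d F : i <= q -> i < k -> k < 2 * q + 2 - i -> x \in B k -> #|F| <= n ->
    W - 5 * n <= #|[set z in B (side d i) | dedge D d x z] :\: F|.
  move=> iq ik ki xk cF; have [|_ cB] := hB (side d i); first by rewrite /side; case: (d); lia.
  have ce : #|[set z in B (side d i) | ~~ dedge D d x z]| <= 4 * n.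
    rewrite /side; case: d cB => cB.
      by have [||_ h _] := lay k (2 * q + 2 - i); try lia; exact: h.
    by have [||_ _ h] := lay i k; try lia; exact: h.
  by have := card_good ce cF; lia.
have sideX d i : i <= q -> B (side d i) \subset X.
  by move=> iq; have [|] := hB (side d i) => //; rewrite /side; case: (d); lia.
have main i : i <= q -> forall (t : otree nat) k x d F, osize t < 2 ^ i * m.+1 ->
    i < k -> k < 2 * q + 2 - i -> x \in B k -> #|F| + osize t <= n ->
    exists w U, [/\ emb D t w U, U \subset zone i :\: F & dedge D d x w].
  elim: i => [|i IH] iq t k x d F szt ik ki xk szF.
    have cF : #|F| <= n by lia.
    have cJ := pick _ _ _ d _ iq ik ki xk cF.
    have [|||w [U [e /subsetP s]]] := sX ([set z in B (side d 0) | dedge D d x z] :\: F) _ _ t.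
    - apply: subset_trans (sideX d 0 iq); apply/subsetP => z; by rewrite !inE => /and3P[].
    - by lia.
    - by rewrite expn0 mul1n ltnS in szt.
    have wU := s _ (emb_root e); exists w, U; split=> //; last by move: wU; rewrite !inE => /and3P[].
    apply/subsetP => z /s; rewrite !inE => /and3P[-> zB _] /=; apply/existsP; exists ord0.
    by move: zB; rewrite /side subn0; case: (d) => ->; rewrite ?orbT.
  have cF : #|F| <= n by lia.
  have cJ := pick _ _ _ d _ iq ik ki xk cF.
  set J := _ :\: F in cJ.
  have JB z : z \in J -> [/\ z \in B (side d i.+1), z \notin F & dedge D d x z].
    by rewrite !inE => /and3P[].
  have JX : J \subset X by apply: subset_trans (sideX d _ iq); apply/subsetP => z /JB[].
  have [||||v [p [op up sp]]] := @oriented_path_in _ D J n kappa _ _ _ (spine (2 ^ i * m.+1) t).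
  - by move=> Y YJ; apply: nd; apply: subset_trans JX.
  - by move=> Y YJ; apply: hX; apply: subset_trans JX.
  - by lia.
  - by have := size_spine (2 ^ i * m.+1) t; lia.
  have side_i : i < side d i.+1 < 2 * q + 2 - i by rewrite /side; case: (d); lia.
  have [|||U [e s]] := @attach D n (2 ^ i * m.+1) J (zone i) _ _ t v p F _ sp up op szF.
  - rewrite -setI_eq0; apply/eqP/setP => z; rewrite in_set0 in_setI; apply/negP => /andP[/JB[zB _ _]].
    by apply/negP; case/andP: side_i => a b; apply: dis a b zB.
  - move=> c szc y d' F' /JB[yB _ _] szF'; case/andP: side_i => a b.
    by apply: (IH _ c (side d i.+1)); rewrite ?(ltnW iq).
  - by move: szt; rewrite expnS; lia.
  have vJ : v \in J by apply: sp; rewrite mem_head.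
  exists v, U; split=> //; last by case: (JB v vJ).
  apply/subsetP => z /(subsetP s); rewrite inE => /orP[|].
    rewrite inE => /sp /JB[zB zF _]; rewrite inE zF /= inE; apply/existsP; exists ord_max.
    by move: zB; rewrite /side /=; case: (d) => ->; rewrite ?orbT.
  rewrite !inE => /andP[-> /= /existsP[j hj]]; apply/existsP.
  by exists (widen_ord (leqnSn _) j).
move=> t szt.
(* An anchor: the whole tree is treated as a subtree hung from [x], which itself stays outside the
   image. *)
have [x xB] : exists x, x \in B q.+1.
  by apply/set0Pn; rewrite -card_gt0; have [|_ ->] := hB q.+1; lia.
have [||||w [U [e s _]]] := main q (leqnn q) t q.+1 x true set0 _ _ _ xB; rewrite ?cards0; try lia.
exists w, U; split=> //; apply: subset_trans s _; rewrite setD0; exact: zoneX.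
Qed.

End EmbedTree.

(** * Chains and longest paths *)

Section Labels.
Variable V : finType.
Implicit Types (D : rel V) (X Y Z A B : {set V}) (s t I : seq V) (l : V -> nat).

(** Labelling in the manner of Gallai and Roy: [l x] counts the vertices of a longest path of [D]
    that ends in [x] and runs forward along [s]. *)
Lemma forward_labels D s : uniq s -> exists l,
  (forall x, x \in s -> exists t, [/\ uniq (rcons t x), sorted D (rcons t x),
      {subset rcons t x <= s} & l x = (size t).+1]) /\
  (forall x y, x \in s -> y \in s -> index x s < index y s -> D x y -> l x < l y).
Proof.
elim/last_ind: s => [|s y IH]; first by exists (fun=> 0).
rewrite rcons_uniq => /andP[ys us]; have [l [l1 l2]] := IH us.
pose Q := [set x in s | D x y]; pose m := \max_(x in Q) l x.
exists (fun z => if z == y then m.+1 else l z); split=> [x|x z].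
  rewrite mem_rcons inE; case: eqVneq => [-> _|xy /= xs].
    have [Q0|] := posnP #|Q|.
      exists [::]; split=> //; first by move=> z; rewrite inE => /eqP->; rewrite mem_rcons mem_head.
      by rewrite /m big_pred0 // => z; move/eqP: Q0; rewrite cards_eq0 => /eqP->; rewrite inE.
    move=> /(eq_bigmax_cond l)[a]; rewrite inE => /andP[as_ Day] em.
    have [t [ut st sub e]] := l1 _ as_; exists (rcons t a); split.
    + by rewrite rcons_uniq ut andbT; apply: contra ys => /sub.
    + by move: st; case: (t) => [|a' t'] /=; rewrite ?Day // !rcons_path last_rcons => /andP[-> ->].
    + by move=> z; rewrite !mem_rcons !inE => /orP[->//|h]; rewrite (sub z) ?orbT // mem_rcons inE.
    + by rewrite size_rcons /m em e.
  have [t [ut st sub e]] := l1 _ xs; exists t; split=> //.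
  by move=> z /sub zs; rewrite mem_rcons inE zs orbT.
rewrite !mem_rcons !inE -cats1 !index_cat.
case: (eqVneq x y) => [->|xy] /=; case: (eqVneq z y) => [->|zy] //=.
- by rewrite (negPf ys) eqxx ltnNge leq_add2l.
- by move=> _ zs; rewrite (negPf ys) zs /= eqxx addn0 ltnNge index_size.
- move=> xs _ _ Dxy; rewrite ltnS; apply: leq_bigmax_cond; by rewrite inE xs.
- by move=> xs zs; rewrite xs zs; apply: l2.
Qed.

Definition low l b s := count (fun y => l y <= b) s.
Definition high l b s := count (fun y => b <= l y) s.

(** A vertex counted before the cut [c] and one counted after it always form an inversion of the
    labels. *)
Definition rich l b I :=
  (0 < size I) && has (fun c => (size I <= 10 * high l b (take c I)) &&
                               (size I <= 10 * low l b (drop c I))) (iota 0 (size I).+1).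

Lemma high_low l b s : size s <= high l b s + low l b s.
Proof. by rewrite /high /low; elim: s => //= x s; case: leqP; lia. Qed.

(** The prefix is cut in the middle. By induction few labels of the first half are low, so if more
    than a fifth of the whole were low, a tenth would be high before the cut and a tenth low after
    it. *)
Lemma sparse_of_not_rich l x s :
  (forall m, m <= size s -> ~~ rich l (l x) (x :: take m s)) ->
  forall m, m <= size s -> 5 * low l (l x) (take m s) <= m + 1.
Proof.
move=> nr m; have [k] := ubnP m; elim: k m => // k IH m; rewrite ltnS => mk ms.
case: m => [|m] in mk ms *; first by rewrite take0.
set d := m.+1./2; have dm : d <= m by rewrite /d; lia.
have low_d : 5 * low l (l x) (take d s) <= d + 1 by apply: IH; lia.
rewrite leqNgt; apply/negP => big; have := nr _ ms; rewrite /rich; set cs := iota _ _; rewrite andTb => /hasPn H.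
have szt : size (take m.+1 s) = m.+1 by rewrite size_take_min; lia.
have /H/negP[] : d.+1 \in cs by rewrite mem_iota /= szt; lia.
have -> : take d.+1 (x :: take m.+1 s) = x :: take d s by rewrite /= take_takel //; lia.
have -> : drop d.+1 (x :: take m.+1 s) = drop d (take m.+1 s) by [].
have -> : size (x :: take m.+1 s) = m.+2 by rewrite /= szt.
have hl := high_low l (l x) (take d s); have szd : size (take d s) = d by rewrite size_take_min; lia.
have split_low : low l (l x) (take m.+1 s) = low l (l x) (take d s) + low l (l x) (drop d (take m.+1 s)).
  by rewrite -{1}(cat_take_drop d (take m.+1 s)) /low count_cat take_takel //; lia.
have -> : high l (l x) (x :: take d s) = (high l (l x) (take d s)).+1 by rewrite /high /= leqnn.
rewrite /d in low_d split_low szd hl *; lia.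
Qed.

(** Greedy scan with threshold [b] and credit [c]. A head with label at most [b] is paid from the
    credit. At a larger label either a rich segment is cut out, or the threshold rises to this
    label, which happens at most [p - b] times. *)
Lemma select_rich_from l p k s b c :
  size s < k -> b <= p -> {in s, forall x, l x <= p} ->
  (forall m, m <= size s -> 5 * low l b (take m s) <= m + c) ->
  exists Is : seq (seq V), [/\ forall I, I \in Is -> exists b, rich l b I,
    subseq (flatten Is) s &
    5 * size s <= 5 * size (flatten Is) + 5 * (p - b) + size s + c].
Proof.
elim: k s b c => // k IH s b c; rewrite ltnS => szs bp lp lowb.
case: s => [|x s] in szs lp lowb *; first by exists [::]; split=> //=; lia.
have lxp : l x <= p by apply: lp; rewrite mem_head.
have lps : {in s, forall y, l y <= p} by move=> y ys; apply: lp; rewrite inE ys orbT.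
have [lx|lx] := leqP (l x) b.
  (* Dropping the head costs 5, of which [size s] repays 1 and the credit 4. *)
  have c4 : 4 <= c by have := lowb 1 isT; rewrite /low /= lx take0 /=; lia.
  have [||Is [h1 h2 h3]] := IH s b (c - 4) _ bp lps; first exact: szs.
    by move=> m ms; have := lowb m.+1 ms; rewrite /low /= lx; lia.
  exists Is; split=> //; first exact: subseq_trans h2 (subseq_cons _ _).
  by move: h3 => /=; lia.
have [/hasP[m]|/hasPn nr] :=
    boolP (has (fun m => rich l (l x) (x :: take m s)) (iota 0 (size s).+1)).
  rewrite mem_iota add0n ltnS => ms rI.
  have [|||Is [h1 h2 h3]] := IH (drop m s) b (c + m.+1) _ bp.
  - by rewrite size_drop; move: szs => /=; lia.
  - by move=> y /mem_drop /lps.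
  - move=> j; rewrite size_drop => js; have := lowb (m.+1 + j); rewrite /= => /(_ _).
    have -> : take (m + j) s = take m s ++ take j (drop m s).
      by rewrite -{1}(cat_take_drop m s) take_cat size_take_min (minn_idPl ms) ltnNge leq_addr /= addKn.
    by rewrite /low /= count_cat; lia.
  exists ((x :: take m s) :: Is); split.
  - by move=> I; rewrite inE => /predU1P[->|/h1]; first by exists (l x).
  - by rewrite /= eqxx -{2}(cat_take_drop m s); apply: cat_subseq.
  - by move: h3; rewrite /= size_cat size_drop size_take_min (minn_idPl ms); lia.
have [||Is [h1 h2 h3]] := IH s (l x) 1 _ lxp lps; first exact: szs.
  apply: sparse_of_not_rich => m ms; apply: nr; by rewrite mem_iota add0n ltnS.
exists Is; split=> //; first exact: subseq_trans h2 (subseq_cons _ _).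
by move: h3 => /=; lia.
Qed.

Lemma select_rich l p s :
  {in s, forall x, 0 < l x <= p} ->
  exists Is : seq (seq V), [/\ forall I, I \in Is -> exists b, rich l b I,
    subseq (flatten Is) s & 4 * size s <= 5 * size (flatten Is) + 5 * p].
Proof.
move=> lp; have [||Is [h1 h2 h3]] := @select_rich_from l p (size s).+1 s 0 0 (leqnn _) (leq0n _).
- by move=> x /lp /andP[].
- move=> m _; suff -> : low l 0 (take m s) = 0 by lia.
  apply/eqP; rewrite -leqn0 leqNgt -has_count; apply/hasPn => x /mem_take /lp /andP[].
  by case: (l x).
by exists Is; split=> //; lia.
Qed.

End Labels.

(** What [pl (dual D)] and [unum (dual D)] have in common; the third clause is superadditivity when
    [dual D] is complete from [A] to [B]. *)
Definition capacity (V : finType) (D : rel V) (u : {set V} -> nat) : Prop :=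
  [/\ forall A B : {set V}, A \subset B -> u A <= u B,
      forall x (A : {set V}), x \in A -> 0 < u A,
      forall A B : {set V}, [disjoint A & B] -> (forall a b, a \in A -> b \in B -> ~~ D b a) ->
        u A + u B <= u (A :|: B) &
      forall t Y, dense (dual D) t Y -> t <= u Y].

Section Chains.
Variables (V : finType) (D : rel V) (u : {set V} -> nat).
Hypothesis cap : capacity D u.
Implicit Types (X Y Z A B : {set V}) (s t I : seq V) (l : V -> nat).

Definition exact A B := [disjoint A & B] /\ (forall a b, a \in A -> b \in B -> ~~ D b a).

Lemma capacity_mono A B : A \subset B -> u A <= u B.
Proof. by case: cap => h _ _ _; apply: h. Qed.

Lemma capacity_exact A B : exact A B -> u A + u B <= u (A :|: B).
Proof. by case: cap => _ _ h _ [d e]; apply: h. Qed.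

Definition set_of I : {set V} := [set x in I].

Lemma card_count s (P : pred V) : uniq s -> #|[set x in s | P x]| = count P s.
Proof.
move=> us; have -> : [set x in s | P x] = [set x in filter P s].
  by apply/setP => x; rewrite !inE mem_filter andbC.
by rewrite cardsE (card_uniqP (filter_uniq P us)) size_filter.
Qed.

(** Between the high part before the cut and the low part after it there is no edge of [D] in either
    direction, so they form a complete bipartite piece of [dual D], which is dense. *)
Lemma capacity_rich l b I : uniq I ->
  (forall x y, x \in I -> y \in I -> index x I < index y I -> l y <= l x ->
     ~~ D x y && ~~ D y x) ->
  rich l b I -> size I <= 10 * u (set_of I).
Proof.
move=> uI inv /andP[I0 /hasP[c _ /andP[hA hB]]].
have ut : uniq (take c I) by apply: take_uniq.
have ud : uniq (drop c I) by apply: drop_uniq.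
pose A := [set x in take c I | b <= l x]; pose B := [set x in drop c I | l x <= b].
have cA : #|A| = high l b (take c I) by apply: card_count.
have cB : #|B| = low l b (drop c I) by apply: card_count.
have AB x y : x \in A -> y \in B -> ~~ D x y && ~~ D y x.
  rewrite !inE => /andP[xA lx] /andP[yB ly].
  apply: inv; [exact: mem_take xA|exact: mem_drop yB| |exact: leq_trans lx].
  rewrite -{1 2}(cat_take_drop c I) !index_cat xA.
  have /negPf-> : y \notin take c I.
    apply/negP => yA; move: uI; rewrite -{1}(cat_take_drop c I) cat_uniq => /and3P[_ /hasPn/(_ _ yB)].
    by rewrite /= yA.
  by apply: leq_trans (leq_addr _ _); rewrite index_mem.
have sub : A :|: B \subset set_of I.
  by apply/subsetP => x; rewrite !inE => /orP[/andP[/mem_take->]|/andP[/mem_drop->]].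
apply: leq_trans (_ : 10 * minn #|A| #|B| <= _); first by rewrite minnMr leq_min cA cB hA hB.
rewrite leq_mul2l /=; apply: leq_trans (capacity_mono sub).
case: cap => _ _ _; apply; apply/andP; split.
  by rewrite -card_gt0 (leq_trans _ (subset_leq_card (subsetUl _ _))) // cA; lia.
apply/forall_inP => y; rewrite inE => /orP[yA|yB].
  apply/andP; split; apply: leq_trans (geq_minr _ _) (subset_leq_card _);
    apply/subsetP => x xB; rewrite 2!inE xB orbT /= /dual; by case/andP: (AB y x yA xB).
apply/andP; split; apply: leq_trans (geq_minl _ _) (subset_leq_card _);
  apply/subsetP => x xA; rewrite 2!inE xA /= /dual; by case/andP: (AB x y xA yB).
Qed.

Fixpoint chain (zs : seq {set V}) : Prop :=
  if zs is z :: zs' then exact z (\bigcup_(y <- zs') y) /\ chain zs' else True.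

Lemma chain_capacity zs : chain zs -> \sum_(z <- zs) u z <= u (\bigcup_(z <- zs) z).
Proof.
elim: zs => [|z zs IH] /=; first by rewrite big_nil.
case=> e /IH le; rewrite !big_cons; apply: leq_trans (capacity_exact e).
by rewrite leq_add2l.
Qed.

Definition before s : rel V := fun x y => index x s < index y s.

Lemma before_trans s : transitive (before s).
Proof. by move=> y x z; apply: ltn_trans. Qed.

Lemma pairwise_before s : uniq s -> pairwise (before s) s.
Proof.
elim: s => //= x s IH /andP[xs us]; apply/andP; split.
  apply/allP => y ys; rewrite /before /= eqxx.
  by case: eqVneq => [e|//]; move: xs; rewrite e ys.
have : pairwise (before s) s by apply: IH.
apply: (@sub_in_pairwise _ (mem s)); last by apply/allP.
move=> a b /= aS bS; rewrite /before /=.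
case: eqVneq => [e|_]; first by move: xs; rewrite e aS.
by case: eqVneq => [e|//]; move: xs; rewrite e bS.
Qed.

Lemma before_of_pairwise s I x y : pairwise (before s) I ->
  x \in I -> y \in I -> index x I < index y I -> before s x y.
Proof.
move=> /(pairwise_sorted) sI xI yI.
exact: (sorted_ltn_index (@before_trans s) sI).
Qed.

Fixpoint odds T (r : seq T) : seq T :=
  match r with
  | x :: _ :: r' => x :: odds r'
  | _ => r
  end.

Lemma sum_odds T (r : seq T) (f : T -> nat) :
  \sum_(x <- r) f x = \sum_(x <- odds r) f x + \sum_(x <- odds (behead r)) f x.
Proof.
have [k] := ubnP (size r); elim: k r => // k IH [|x [|y r]] /= sz.
- by rewrite !big_nil.
- by rewrite !big_cons !big_nil !addn0.
- have e := IH r; rewrite !big_cons e; last by lia.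
  case: r {e} sz => [|z r] _ /=; by rewrite !big_cons ?big_nil; lia.
Qed.

Lemma rich_inversion l b I R : rich l b I -> pairwise R I ->
  exists x y, [/\ x \in I, y \in I, R x y & l y <= l x].
Proof.
case/andP=> I0 /hasP[c _ /andP[hA hB]].
have /hasP[x xA lx] : has (fun z => b <= l z) (take c I).
  by rewrite has_count; move: hA; rewrite /high; lia.
have /hasP[y yB ly] : has (fun z => l z <= b) (drop c I).
  by rewrite has_count; move: hB; rewrite /low; lia.
rewrite -(cat_take_drop c I) pairwise_cat => /and3P[/allrelP h _ _].
exists x, y; rewrite !mem_cat xA yB orbT; split=> //; first exact: h.
exact: leq_trans ly lx.
Qed.

Section Sequence.
Variables (s : seq V) (l : V -> nat).
Hypothesis us : uniq s.
Hypothesis inv : forall x y, x \in s -> y \in s -> before s x y -> l y <= l x ->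
  ~~ D x y && ~~ D y x.
Hypothesis grp : forall x y1 y2 z, x \in s -> y1 \in s -> y2 \in s -> z \in s ->
  before s x y1 -> before s y1 y2 -> before s y2 z -> D z x -> l y1 < l y2.

(** By [grp] no edge of [D] leads back across a pair whose labels do not increase, and each rich
    segment contains such a pair. Skipping every second segment therefore makes the others exact to
    each other, and [u] adds up. *)
Lemma odds_capacity Is :
  (forall I, I \in Is -> exists b, rich l b I) ->
  pairwise (before s) (flatten Is) -> {subset flatten Is <= s} ->
  \sum_(I <- odds Is) u (set_of I) <= u (set_of (flatten Is)).
Proof.
have [k] := ubnP (size Is); elim: k Is => // k IH [|I1 [|I2 Is]] /= sz rI pw sub.
- by rewrite big_nil.
- by rewrite big_cons big_nil addn0 cats0.
rewrite big_cons.
have [b2 r2] : exists b, rich l b I2 by apply: rI; rewrite !inE eqxx orbT.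
move: pw; rewrite pairwise_cat => /and3P[/allrelP R1 _].
rewrite pairwise_cat => /and3P[/allrelP R2 p2 p3].
have [y1 [y2 [y1I y2I y12 ly]]] := rich_inversion r2 p2.
have le : \sum_(I <- odds Is) u (set_of I) <= u (set_of (flatten Is)).
  apply: IH; [exact: ltnW sz| |exact: p3|].
    by move=> I hI; apply: rI; rewrite !inE hI !orbT.
  by move=> x xI; apply: sub; rewrite !mem_cat xI !orbT.
have ex : exact (set_of I1) (set_of (flatten Is)).
  split.
    rewrite -setI_eq0; apply/eqP/setP => x; rewrite !inE; apply/negP => /andP[x1 x3].
    have := R1 x x x1; rewrite mem_cat x3 orbT => /(_ isT).
    by rewrite /before ltnn.
  move=> x z; rewrite !inE => x1 z3; apply/negP => Dzx.
  suff : l y1 < l y2 by rewrite ltnNge ly.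
  apply: (grp (x := x) (z := z)) => //; rewrite ?sub ?mem_cat ?x1 ?z3 ?y1I ?y2I ?orbT //.
  - by apply: R1 => //; rewrite mem_cat y1I.
  - exact: R2.
apply: leq_trans (leq_add (leqnn _) le) _; apply: leq_trans (capacity_exact ex) _.
apply: capacity_mono; apply/subsetP => x; rewrite !inE !mem_cat => /orP[->//|->].
by rewrite !orbT.
Qed.

(** The rich segments of either parity have total capacity at most [u X], so all together they have
    at most [20 * u X] elements; [select_rich] gives the rest. *)
Lemma sequence_bound X p : {subset s <= X} -> {in s, forall x, 0 < l x <= p} ->
  4 * size s <= 5 * p + 100 * u X.
Proof.
move=> sX lp; have [Is [rI sq le]] := select_rich lp.
have pw : pairwise (before s) (flatten Is).
  by apply: subseq_pairwise sq (pairwise_before us).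
have sub : {subset flatten Is <= s} by apply: mem_subseq.
have oX Js : {subset flatten Js <= s} -> u (set_of (flatten Js)) <= u X.
  by move=> h; apply: capacity_mono; apply/subsetP => x; rewrite inE => /h/sX.
have o1 := leq_trans (odds_capacity rI pw sub) (oX _ sub).
have o2 : \sum_(I <- odds (behead Is)) u (set_of I) <= u X.
  case: Is rI sq le pw sub {o1} => [|I Is] rI sq le pw sub; first by rewrite big_nil.
  have sub' : {subset flatten Is <= s} by move=> x xI; apply: sub; rewrite /= mem_cat xI orbT.
  apply: leq_trans (oX _ sub'); apply: odds_capacity sub'.
    by move=> J hJ; apply: rI; rewrite inE hJ orbT.
  by move: pw; rewrite /= pairwise_cat => /and3P[].
have : size (flatten Is) <= 10 * \sum_(I <- Is) u (set_of I).
  elim: Is rI pw sub {sq le o1 o2} => [|I Is IH] rI pw sub; first by rewrite big_nil.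
  move: pw; rewrite /= pairwise_cat => /and3P[_ p1 p2].
  have subI : {subset I <= s} by move=> x xI; apply: sub; rewrite /= mem_cat xI.
  rewrite big_cons mulnDr size_cat leq_add //.
    have [b rb] := rI I (mem_head _ _); apply: (capacity_rich (l := l) (b := b)) => //.
      apply: sorted_uniq (pairwise_sorted p1); first exact: before_trans.
      by move=> x; rewrite /before ltnn.
    move=> x y xI yI ixy; apply: inv; [exact: subI|exact: subI|].
    exact: before_of_pairwise p1 xI yI ixy.
  apply: IH => // [J hJ|x xI]; first by apply: rI; rewrite inE hJ orbT.
  by apply: sub; rewrite /= mem_cat xI orbT.
rewrite sum_odds => h; move: le o1 o2 h; set a := \sum_(x <- _) _; set b := \sum_(x <- _) _; set f := size (flatten Is); set x := size s; set y := u X; lia.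
Qed.

End Sequence.

Lemma path_labels t l : uniq t -> sorted D t ->
  (forall a b, a \in t -> b \in t -> before t a b -> D a b -> l a < l b) ->
  forall x y, x \in t -> y \in t -> before t x y -> l x < l y.
Proof.
move=> ut st h x y xt yt bxy.
have tr : transitive (fun a b : V => l a < l b) by move=> ? ? ?; apply: ltn_trans.
apply: (sorted_ltn_index tr) bxy => //.
apply/(sortedP x) => i hi; apply: h; rewrite ?mem_nth //; try lia.
  by rewrite /before !index_uniq //; lia.
by apply/(sortedP x).
Qed.

(** [s] concatenates longest paths of the pieces, and [g x] is the index of the piece that contains
    [x]. *)
Lemma chain_list zs : chain zs -> exists s (g : V -> nat),
  [/\ uniq s, {subset s <= \bigcup_(z <- zs) z}, size s = \sum_(z <- zs) pl D z &
   forall x y, x \in s -> y \in s -> before s x y ->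
     [/\ g x <= g y, g x < g y -> ~~ D y x &
       g x = g y -> forall l : V -> nat,
         (forall a b, a \in s -> b \in s -> before s a b -> D a b -> l a < l b) -> l x < l y]].
Proof.
elim: zs => [|z zs IH] /=.
  by move=> _; exists [::], (fun=> 0); split=> //; rewrite big_nil.
case=> [[dis ex] /IH[s [g [us sub szs hs]]]].
have [t [szt ut st tz]] := pl_path (leqnn (pl D z)).
have ntz x : x \in s -> x \in z = false.
  move=> /sub xs; apply/negP => xz; move/pred0P: dis => /(_ x) /=; by rewrite xz xs.
have nts x : x \in t -> x \in s = false.
  by move=> /tz xz; apply/negP => /ntz; rewrite xz.
have nst x : x \in s -> x \in t = false.
  by move=> xs; apply/negP => /nts; rewrite xs.
have bst a b : a \in s -> b \in s -> before (t ++ s) a b = before s a b.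
  by move=> /nst ha /nst hb; rewrite /before !index_cat ha hb ltn_add2l.
have btt a b : a \in t -> b \in t -> before (t ++ s) a b = before t a b.
  by move=> ha hb; rewrite /before !index_cat ha hb.
exists (t ++ s), (fun x => if x \in z then 0 else (g x).+1); split.
- rewrite cat_uniq ut us andbT; apply/hasPn => x xs; by rewrite /= nst.
- move=> x; rewrite mem_cat big_cons inE => /orP[/tz->//|/sub->]; by rewrite orbT.
- by rewrite size_cat szt szs big_cons.
move=> x y; rewrite !mem_cat => /orP[xt|xs] /orP[yt|ys].
- rewrite !tz // btt // => bxy; split=> // _ l hl.
  apply: path_labels xt yt bxy => // a b at_ bt ab; apply: hl; rewrite ?mem_cat ?at_ ?bt //.
  by rewrite btt.
- by rewrite tz // ntz // => _; split=> // _; apply: ex; [exact: tz|exact: sub].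
- by rewrite /before !index_cat (nst _ xs) yt ltnNge (leq_trans (index_size _ _)) ?leq_addr.
- rewrite !ntz // bst // => bxy; have [h1 h2 h3] := hs _ _ xs ys bxy.
  split=> // -[/h3 h4] l hl; apply: h4 => a b as_ bs ab.
  by apply: hl; rewrite ?mem_cat ?as_ ?bs ?orbT // bst.
Qed.

(** A pair with non-increasing labels lies in different pieces, where the chain excludes backward
    edges and the labels exclude forward ones. A backward edge forces everything between its ends
    into one piece. So [sequence_bound] applies. *)
Lemma chain_path zs X : chain zs -> (forall z, z \in zs -> z \subset X) ->
  4 * \sum_(z <- zs) pl D z <= 5 * pl D X + 100 * u X.
Proof.
move=> cz zX; have [s [g [us sub <- hs]]] := chain_list cz.
have sX : {subset s <= X}.
  move=> x /sub; elim: zs zX {cz sub hs} => [|z zs IH] zX; first by rewrite big_nil inE.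
  rewrite big_cons inE => /orP[|/IH h]; first by apply/subsetP/zX; rewrite mem_head.
  by apply: h => z' hz; apply: zX; rewrite inE hz orbT.
have [l [l1 l2]] := forward_labels D us.
apply: (@sequence_bound s l) => //.
- move=> x y xs ys bxy lyx; have [h1 h2 h3] := hs _ _ xs ys bxy.
  apply/andP; split; first by apply/negP => /(l2 _ _ xs ys bxy); rewrite ltnNge lyx.
  apply: h2; rewrite ltn_neqAle h1 andbT; apply/eqP => /h3/(_ l l2).
  by rewrite ltnNge lyx.
- move=> x y1 y2 z xs y1s y2s zs' b1 b2 b3 Dzx.
  have b13 := before_trans b1 (before_trans b2 b3).
  have [a1 a2 _] := hs _ _ xs zs' b13.
  have gxz : g z <= g x by rewrite leqNgt; apply/negP => /a2; rewrite Dzx.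
  have [c1 _ _] := hs _ _ xs y1s b1; have [d1 _ d3] := hs _ _ y1s y2s b2.
  have [e1 _ _] := hs _ _ y2s zs' b3; apply: d3 l2; lia.
- move=> x xs; have [t [ut st subt ->]] := l1 _ xs; rewrite /= -(size_rcons t x).
  by apply: pl_geP => // y /subt /sX.
Qed.

End Chains.

(** * Winding paths and breadth-first partitions *)

Lemma size_flatten_le (T : eqType) (qs : seq (seq T)) k :
  (forall q, q \in qs -> size q <= k) -> size (flatten qs) <= size qs * k.
Proof.
elim: qs => //= q qs IH h; rewrite size_cat mulSn leq_add ?h ?mem_head //.
by apply: IH => q' hq; apply: h; rewrite inE hq orbT.
Qed.

Section Layering.
Variables (V : finType) (D : rel V).
Implicit Types (X Y Z U W R L M F J P : {set V}).

Fixpoint ball Y R i : {set V} :=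
  if i is j.+1 then ball Y R j :|: [set y in Y | [exists x in ball Y R j, D x y]] else R.

Lemma ball_sub Y R i : R \subset Y -> ball Y R i \subset Y.
Proof.
move=> RY; elim: i => //= i IH; rewrite subUset IH /=.
by apply/subsetP => x; rewrite inE => /andP[].
Qed.

Lemma ball_path Y R i y : R \subset Y -> y \in ball Y R i ->
  exists x p, [/\ x \in R, path D x p, {subset x :: p <= Y}, last x p = y & size p <= i].
Proof.
move=> RY; elim: i y => [|i IH] y /=.
  move=> yR; exists y, [::]; split=> // z; rewrite inE => /eqP->; exact: (subsetP RY).
rewrite !inE => /orP[/IH[x [p [h1 h2 h3 h4 h5]]]|].
  by exists x, p; split=> //; apply: leqW.
case/andP=> yY /exists_inP[z /IH[x [p [h1 h2 h3 h4 h5]]] Dzy].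
exists x, (rcons p y); split=> //.
- by rewrite rcons_path h2 h4.
- by move=> a; rewrite -rcons_cons mem_rcons inE => /predU1P[->|/h3].
- by rewrite last_rcons.
- by rewrite size_rcons ltnS.
Qed.

(* If every path from [R] to [L] is long then one of the first [k]
   breadth-first spheres around [R] is thin; removing it leaves no edge across. *)
Lemma bfs_split Y R L k : 0 < k -> R \subset Y -> L \subset Y ->
  (forall x p, x \in R -> path D x p -> uniq (x :: p) -> {subset x :: p <= Y} ->
     last x p \in L -> k < size p) ->
  exists U W, [/\ U \subset Y, W \subset Y, R \subset U & L \subset W] /\
    exact D W U /\ k * #|Y| <= k * (#|U| + #|W|) + #|Y|.
Proof.
move=> k0 RY LY far; pose Bl := ball Y R.
have BY i : Bl i \subset Y by apply: ball_sub.
have BS i : Bl i \subset Bl i.+1 by apply: subsetUl.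
have RB i : R \subset Bl i by elim: i => // i IH; apply: subset_trans IH (BS i).
have BL i : i <= k -> [disjoint L & Bl i].
  move=> ik; rewrite -setI_eq0; apply/eqP/setP => y; rewrite !inE; apply/negP => /andP[yL].
  case/(ball_path RY)=> x [p [h1 h2 h3 h4 h5]]; case/shortenP: h2 h4 => p' h2 up sp h4.
  have : k < size p'.
    apply: (far x) => //; last by rewrite h4.
    by move=> z; rewrite inE => /predU1P[->|/sp zp]; apply: h3; rewrite inE ?eqxx ?zp ?orbT.
  rewrite ltnNge; apply/negP/negPn; apply: leq_trans ik; apply: leq_trans h5.
  by apply: uniq_leq_size; [case/andP: up|exact: sp].
(* Otherwise each of the first [k] steps enlarges the ball by more than [#|Y| / k], and the last
   ball outgrows [Y]. *)
have [i ik thin] : exists2 i, i < k & k * #|Bl i.+1| <= k * #|Bl i| + #|Y|.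
  have [/hasP[i]|/hasPn H] := boolP (has (fun i => k * #|Bl i.+1| <= k * #|Bl i| + #|Y|) (iota 0 k)).
    by rewrite mem_iota add0n => /= ik h; exists i.
  have grow j : j <= k -> j * #|Y|.+1 <= k * #|Bl j|.
    elim: j => // j IH jk; have /H : j \in iota 0 k by rewrite mem_iota.
    by have := IH (ltnW jk); rewrite -ltnNge mulSn; lia.
  have := grow k (leqnn k); rewrite leq_pmul2l // => h.
  by have := subset_leq_card (BY k); lia.
exists (Bl i), (Y :\: Bl i.+1); split; [split=> //; first exact: subsetDl|split].
- by rewrite subsetD LY BL.
- split.
    rewrite -setI_eq0; apply/eqP/setP => x; rewrite !inE.
    by apply/negP => /andP[/andP[h _] h2]; move/negP: h; apply; rewrite h2.
  move=> a b; rewrite !inE negb_or => /andP[/andP[_ h] aY] bB; move: h; rewrite aY /=.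
  by apply: contra => Dba; apply/exists_inP; exists b.
- have := cardsD Y (Bl i.+1); rewrite (setIidPr (BY i.+1)) => ->.
  by have := subset_leq_card (BY i.+1); nia.
Qed.

Definition goes_back R L q :=
  if q is x :: p then [&& x \in R, path D x p & last x p \in L] else false.

(** Short paths from [R] to [L] are collected greedily; when none is left, the union [F] of those
    collected meets all of them. *)
Lemma short_back_paths Y R L k j : R \subset Y -> L \subset Y ->
  (exists qs, [/\ size qs = j, uniq (flatten qs), {subset flatten qs <= Y} &
     forall q, q \in qs -> goes_back R L q && (size q <= k.+1)]) \/
  (exists F : {set V}, #|F| <= j * k.+1 /\
     forall x p, x \in R :\: F -> path D x p -> uniq (x :: p) -> {subset x :: p <= Y :\: F} ->
       last x p \in L :\: F -> k < size p).
Proof.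
move=> RY LY; elim: j => [|j [[qs [h1 h2 h3 h4]]|[F [h1 h2]]]]; first by left; exists [::].
  have szF : size (flatten qs) <= j * k.+1.
    by rewrite -h1; apply: size_flatten_le => q /h4 /andP[].
  pose F := [set x in flatten qs].
  have [[x [p [a1 a2 a3 a4 [a5 a6]]]]|none] := classic (exists x p,
     [/\ x \in R :\: F, path D x p, uniq (x :: p), {subset x :: p <= Y :\: F} &
       last x p \in L :\: F /\ size p <= k]).
    left; exists ((x :: p) :: qs); split.
    - by rewrite /= h1.
    - rewrite -[flatten _]/((x :: p) ++ flatten qs) cat_uniq a3 h2 andbT /=; apply/hasPn => z zq.
      by apply/negP => /a4; rewrite !inE zq.
    - by move=> z; rewrite -[flatten _]/((x :: p) ++ flatten qs) mem_cat => /orP[/a4|/h3 //]; rewrite !inE => /andP[].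
    - move=> q; rewrite inE => /predU1P[->|/h4 //]; rewrite /= a2 ltnS a6 andbT.
      by move: a1 a5; rewrite !inE => /andP[_ ->] /andP[_ ->].
  right; exists F; split.
    by rewrite mulSn; apply: leq_trans (leq_addl _ _); apply: leq_trans szF; rewrite cardsE card_size.
  by move=> x p *; rewrite ltnNge; apply/negP => h; apply: none; exists x, p; split.
right; exists F; split=> //; rewrite mulSn; apply: leq_trans (leq_addl _ _); exact: h1.
Qed.

(* Consecutive back paths are joined by paths of [m] vertices in [M]. *)
Lemma winding L M R F e m b :
  (forall y, y \in L -> #|[set z in M | ~~ D y z]| <= e) ->
  (forall x, x \in R -> #|[set z in M | ~~ D z x]| <= e) ->
  0 < m ->
  (forall J, J \subset M -> #|M| <= #|J| + (2 * e + #|F| + m * b) -> m <= pl D J) ->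
  forall q qs, size qs <= b -> uniq (flatten (q :: qs)) -> {subset flatten (q :: qs) <= F} ->
  {in q :: qs, forall q', goes_back R L q'} ->
  exists x s P, [/\ x \in R, path D x s, uniq (x :: s),
    forall z, z \in x :: s -> (z \in flatten (q :: qs)) || (z \in P) &
    [/\ P \subset M, [disjoint P & F], #|P| <= m * size qs & m * size qs < size (x :: s)]].
Proof.
move=> hL hR m0 hJ q qs; elim: qs q => [|q' qs IH] q szq uq qF back.
  have := back q (mem_head _ _); case: q uq qF {back} => // x p; rewrite -[flatten _]/((x :: p) ++ [::]) cats0.
  move=> up pF /and3P[xR px _]; exists x, p, set0; split=> //.
    by move=> z ->.
  by split; rewrite ?sub0set ?disjoints1 ?cards0 ?muln0 // -setI_eq0 set0I.
move: uq; rewrite -[flatten _]/(q ++ flatten (q' :: qs)) cat_uniq => /and3P[uq /hasPn dq uqs].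
have qF' z : z \in q -> z \in F.
  by move=> zq; apply: qF; rewrite -[flatten _]/(q ++ flatten (q' :: qs)) mem_cat zq.
have qsF z : z \in flatten (q' :: qs) -> z \in F.
  by move=> zq; apply: qF; rewrite -[flatten _]/(q ++ flatten (q' :: qs)) mem_cat zq orbT.
have [|x' [s' [P' [x'R ps us sub [P'M dP' cP szs]]]]] := IH q' (ltnW szq) uqs qsF.
  by move=> q'' hq''; apply: back; rewrite inE hq'' orbT.
have := back q (mem_head _ _); case: q uq qF dq qF' {back} => // x p uq qF dq qF' /and3P[xR px yL].
set y := last x p in yL.
(* The link is sought among the out-neighbours of the end [y] of the first back path that are
   in-neighbours of the start [x'] of the rest, away from all vertices in use. *)
pose J := [set z in M | D y z && D z x'] :\: (F :|: P').
have JM : J \subset M by apply/subsetP => z; rewrite !inE => /andP[_ /andP[]].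
have cJ : #|M| <= #|J| + (2 * e + #|F| + m * b).
  have sM : M \subset J :|: ([set z in M | ~~ D y z] :|: [set z in M | ~~ D z x'] :|: (F :|: P')).
    apply/subsetP => z zM; rewrite !inE zM /=.
    by case: (z \in F); case: (z \in P'); case: (D y z); case: (D z x').
  have c1 := cardsU_le [set z in M | ~~ D y z] [set z in M | ~~ D z x'].
  have c2 := cardsU_le F P'.
  have c3 := cardsU_le ([set z in M | ~~ D y z] :|: [set z in M | ~~ D z x']) (F :|: P').
  have c4 := leq_trans (subset_leq_card sM) (cardsU_le _ _).
  have c5 := hL y yL; have c6 := hR x' x'R.
  have c7 : m * size qs <= m * b by rewrite leq_mul2l (ltnW szq) orbT.
  by move: c1 c2 c3 c4 c5 c6 c7 cP; clear; lia.
have [t [szt ut st tJ]] := pl_path (hJ J JM cJ).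
have tJ' z : z \in t -> [/\ z \in M, D y z, D z x', z \notin F & z \notin P'].
  by move=> /tJ; rewrite !inE negb_or => /andP[/andP[-> ->] /and3P[-> -> ->]].
case: t szt ut st tJ tJ' => [|a t] szt ut st tJ tJ'; first by move: m0; rewrite -szt.
exists x, (p ++ (a :: t) ++ x' :: s'), (P' :|: [set z in a :: t]); split=> //.
- rewrite cat_path px cat_path /=; have [_ -> _ _ _] := tJ' a (mem_head _ _).
  by have [_ _ -> _ _] := tJ' (last a t) (mem_last _ _); rewrite (st : path D a t) ps.
- rewrite -cat_cons cat_uniq uq andTb; apply/andP; split.
    apply/hasPn => z; rewrite mem_cat => /orP[/tJ'[_ _ _ zF _]|/sub/orP[/dq //|]].
      by apply: contra zF => /qF'.
    by move=> zP; apply/negP => /qF'; move/pred0P: dP' => /(_ z) /=; rewrite zP /= => ->.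
  rewrite cat_uniq ut us andbT; apply/hasPn => z /sub zs /=; apply/negP => /tJ'[_ _ _ zF zP].
  by move: zs; rewrite (negPf zP) orbF => /qsF; rewrite (negPf zF).
- move=> z; rewrite -cat_cons [in X in X -> _]mem_cat => h; apply/orP; move: h => /orP[h|].
    by left; rewrite -[X in z \in X]/((x :: p) ++ flatten (q' :: qs)) mem_cat h.
  rewrite [in X in X -> _]mem_cat => /orP[h|/sub/orP[h|h]].
  - by right; rewrite 2!inE h orbT.
  - by left; rewrite -[X in z \in X]/((x :: p) ++ flatten (q' :: qs)) mem_cat h orbT.
  - by right; rewrite inE h.
split.
- by rewrite subUset P'M; apply/subsetP => z; rewrite inE => /tJ'[].
- rewrite -setI_eq0; apply/eqP/setP => z; rewrite !inE; apply/negP => /andP[/orP[zP zF|]].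
    by move/pred0P: dP' => /(_ z) /=; rewrite zP zF.
  by rewrite -in_cons => /tJ'[_ _ _ /negP].
- apply: leq_trans (cardsU_le _ _) _; rewrite mulnS addnC leq_add //.
  by rewrite cardsE -szt card_size.
- rewrite -[size (q' :: qs)]/(size qs).+1 mulnS /= !size_cat -szt /= !size_cat /=.
  move: szs; rewrite -szt /=; clear; lia.
Qed.
End Layering.

(** * Recursive splitting and a size bound with absolute path coefficient *)

Lemma scaled_sqrt r N : 0 < r -> exists k, r * k ^ 2 <= N < r * k.+1 ^ 2.
Proof.
move=> r0; elim: N => [|N [k /andP[h1 h2]]]; first by exists 0; rewrite muln0 muln1.
have [h|h] := ltnP N.+1 (r * k.+1 ^ 2); first by exists k; rewrite h andbT; apply: leqW.
exists k.+1; rewrite h /=; apply: leq_ltn_trans h2 _; rewrite ltn_pmul2l // ltn_exp2r //.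
Qed.

(** Strict concavity of the square root, made quantitative. Both [a] and [b] are at least
    [7 l / 20], and expanding the product of [20 a - 7 l] and [20 b - 7 l] bounds [a b], hence the
    square of [a + b], from below. *)
Lemma sqrt_gain l a b : 199 <= l -> l ^ 2 <= 8 * a ^ 2 -> l ^ 2 <= 8 * b ^ 2 ->
  l ^ 2 <= a ^ 2 + b ^ 2 + (2 * l + 4) -> 32 * l + 64 <= 30 * (a + b).
Proof.
rewrite !expnS !expn0 !muln1 => hl ha hb hab.
have a7 : 7 * l <= 20 * a by nia.
have b7 : 7 * l <= 20 * b by nia.
rewrite leqNgt; apply/negP => h.
have : (20 * a - 7 * l) * (20 * b - 7 * l) >= 0 by [].
nia.
Qed.

Section Decomposition.
Variables (V : finType) (D : rel V) (u : {set V} -> nat).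
Hypothesis cap : capacity D u.
Implicit Types (X Y Z U W J : {set V}).

(** Here [l] is about the square root of [#|Z| / (be + 1)], which balances two losses: [be + 1] back
    paths with at most [l] vertices each, and the sphere discarded by a breadth-first search of
    depth about [l], are both of order [(be + 1) l]. *)
Lemma split_or_path Z al be l :
  (forall J, J \subset Z -> #|J| < #|Z| -> #|J| <= al * u J + be * pl D J) ->
  1000 * (al + 1) * (u Z).+1 <= #|Z| -> 200 * (200 * be.+1) <= #|Z| ->
  be.+1 * l ^ 2 <= #|Z| < be.+1 * l.+1 ^ 2 -> 0 < be ->
  #|Z| <= 60 * pl D Z \/
  exists U W, [/\ U \subset Z, W \subset Z, exact D W U,
    #|Z| <= 8 * #|U| & #|Z| <= 8 * #|W| /\ #|Z| <= #|U| + #|W| + be.+1 * (2 * l + 4)].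
Proof.
move=> hJ big1 big2 /andP[l1 l2] be0; set N := #|Z| in hJ big1 big2 l1 l2 *.
set w := N %/ 6; have wN : 6 * w <= N < 6 * w + 6 by rewrite /w; clear; lia.
have nd Y : Y \subset Z -> ~~ dense (dual D) (u Z).+1 Y.
  move=> YZ; apply/negP => dn; case: (cap) => mono _ _ /(_ _ _ dn).
  by rewrite ltnNge mono.
have [|B [hB lay]] := @layers _ D _ Z 3 w nd; first by rewrite -/N; lia.
have [LZ cL] := hB 0 isT; have [MZ cM] := hB 1 isT; have [RZ cR] := hB 2 isT.
have [dLM LM _] := lay 0 1 isT isT; have [dMR _ MR] := lay 1 2 isT isT.
have [dLR _ _] := lay 0 2 isT isT.
have l200 : 199 < l.
  have : be.+1 * 200 ^ 2 < be.+1 * l.+1 ^ 2.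
    by apply: leq_ltn_trans l2; rewrite mulnC -mulnA.
  by rewrite ltn_pmul2l // ltn_exp2r.
have lw : 9 * (be.+1 * l) <= w.
  have : be.+1 * l * 199 <= be.+1 * l ^ 2 by rewrite expnS expn1 mulnA leq_mul2l ltnW ?orbT.
  have : 0 < be.+1 * l by rewrite muln_gt0; case: (l) l200.
  move: wN l1; set x := be.+1 * l; set y := be.+1 * l ^ 2; clear; lia.
have b1 : 200 * (200 * be.+1) < 6 * w + 6 by move: big2 wN; clear; lia.
case: l => // k in l1 l2 l200 lw *.
have [[qs [sq uq qZ back]]|[F [cF far]]] := short_back_paths D k be.+1 RZ LZ.
  left; case: qs sq uq qZ back => // q qs [sq] uq qZ back.
  pose F := [set x in flatten (q :: qs)].
  have cF : #|F| <= be.+1 * k.+1.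
    rewrite cardsE -sq; apply: leq_trans (card_size _) _.
    by apply: (@size_flatten_le _ (q :: qs)) => q' /back/andP[].
  (* The [be] links have between [w / 8] and [w / 4] vertices in total: enough for a path of linear
     length, and few enough that [hJ] still yields a path of [m] vertices in the rest of [M]. *)
  set m := w %/ (4 * be).
  have m0 : 0 < m by rewrite /m divn_gt0; move: be0 b1; clear; lia.
  have wm : be * m * 4 <= w by have := leq_trunc_div w (4 * be); rewrite -/m; clear; lia.
  have wm2 : w < 8 * (be * m).
    have := ltn_ceil w (_ : 0 < 4 * be); rewrite -/m muln_gt0 be0 => /(_ isT); have : be <= be * m by rewrite leq_pmulr. 
    rewrite mulSn mulnC; clear; lia.
  have [J JM cJ|||q' hq'|x [s [P [xR ps us sub [PM dPF cP szs]]]]] :=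
      winding (b := be) (F := F) LM MR m0 _ _ uq _ _.
  - have uJ : u J <= u Z by apply: capacity_mono cap _ _ (subset_trans JM MZ).
    have JN : #|J| < N by have := subset_leq_card JM; rewrite cM; move: wN b1; clear; lia.
    have := hJ J (subset_trans JM MZ) JN; rewrite cM in cJ.
    have a1 : al * u J <= (al + 1) * (u Z).+1 by move: uJ; clear => uJ; apply: leq_mul; lia.
    have a2 : (u Z).+1 <= (al + 1) * (u Z).+1 by rewrite leq_pmull // addn1.
    move=> hJJ; rewrite -(leq_pmul2l be0).
    move: a1 a2 big1; rewrite -mulnA; set A := (al + 1) * _; set y := al * _ => a1 a2 big1.
    move: hJJ wm cJ lw cF; rewrite (mulnC m); set z := be * m; set p := be * pl _ _.
    move: wN a1 a2 big1; set rl := be.+1 * _; set f := #|F|; clear; lia.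
  - by rewrite sq.
  - by move=> z; rewrite inE.
  - by have /andP[] := back q' hq'.
  have : size (x :: s) <= pl D Z.
    apply: pl_geP => // z /sub /orP[/qZ //|zP]; exact: (subsetP MZ) (subsetP PM _ zP).
  rewrite sq in szs; move: szs wm2 wN; rewrite (mulnC m); clear; lia.
right.
have RF : B 2 :\: F \subset Z :\: F by apply: setSD.
have LF : B 0 :\: F \subset Z :\: F by apply: setSD.
have k0 : 0 < k by move: l200; clear; lia.
have [U [W [[UY WY RU LW] [ex le]]]] := bfs_split k0 RF LF far.
have cD (X : {set V}) : #|X| <= #|F| + #|X :\: F|.
  by rewrite cardsD; have := subset_leq_card (subsetIr X F); clear; lia.
have c1 := subset_leq_card RU; have c2 := subset_leq_card LW.
have c3 := cD (B 2); have c4 := cD (B 0); have c5 := cD Z.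
have c6 : #|Z :\: F| <= N by apply: subset_leq_card; apply: subsetDl.
exists U, W; split=> //; try exact: subset_trans (subsetDl _ F).
- by move: c1 c3 lw cF wN b1; rewrite cR; clear; lia.
split; first by move: c2 c4 lw cF wN b1; rewrite cL; clear; lia.
have c7 : #|Z :\: F| <= #|U| + #|W| + be.+1 * (k + 5).
  rewrite -(leq_pmul2l k0) mulnDr; apply: leq_trans le _; rewrite leq_add2l.
  apply: leq_trans (leq_trans c6 (ltnW l2)) _; rewrite mulnCA leq_mul2l /=.
  by rewrite !expnS expn0 muln1; move: l200; clear; nia.
have -> : 2 * k.+1 + 4 = k.+1 + (k + 5) by clear; lia.
rewrite mulnDr; move: c5 cF c7; rewrite -/N; clear; lia.
Qed.
End Decomposition.

Section Pieces.
Variables (V : finType) (D : rel V) (u : {set V} -> nat).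
Hypothesis cap : capacity D u.
Implicit Types (A B X Y Z U W J : {set V}).

Lemma chain_cat (zs zs' : seq {set V}) A B :
  chain D zs -> chain D zs' -> (forall z, z \in zs -> z \subset A) ->
  (forall z, z \in zs' -> z \subset B) -> exact D A B -> chain D (zs ++ zs').
Proof.
move=> cz cz' hA hB [dAB ex]; elim: zs cz hA => //= z zs IH [[dz ez] cz] hA.
have zA : z \subset A by apply: hA; rewrite mem_head.
have sB : \bigcup_(y <- zs') y \subset B.
  elim: zs' hB {IH cz'} => [|z' zs' IH] hB; first by rewrite big_nil sub0set.
  rewrite big_cons subUset hB ?mem_head // IH // => y hy.
  by apply: hB; rewrite inE hy orbT.
split; last by apply: IH => // y hy; apply: hA; rewrite inE hy orbT.
rewrite big_cat /=; split.
  by rewrite -setI_eq0 setIUr setU_eq0 !setI_eq0 dz (disjointWl zA (disjointWr sB dAB)).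
move=> a b az; rewrite inE => /orP[|bB]; first exact: ez.
by apply: ex; [exact: (subsetP zA)|exact: (subsetP sB)].
Qed.

(** The term [30 * (be.+1 * l)] is a potential: a split loses at most [(be + 1) (2 l + 4)] vertices,
    and [sqrt_gain] pays for them. Only sets with at least [200 ^ 2 (be + 1)] vertices are split,
    and both sides keep an eighth, hence [70 ^ 2 (be + 1)]. *)
Lemma decompose X Z al be l :
  (forall J, J \subset X -> #|J| < #|X| -> #|J| <= al * u J + be * pl D J) -> 0 < be ->
  Z \subset X -> 70 * (70 * be.+1) <= #|Z| -> be.+1 * l ^ 2 <= #|Z| < be.+1 * l.+1 ^ 2 ->
  exists zs, [/\ chain D zs,
    forall z, z \in zs -> z \subset Z /\
      [\/ #|z| < 200 * (200 * be.+1), #|z| < 1000 * (al + 1) * (u z).+1 | #|z| <= 60 * pl D z],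
    forall z, z \in zs -> 0 < #|z| &
    #|Z| + 30 * (be.+1 * l) <= 2 * \sum_(z <- zs) #|z|].
Proof.
move=> hJ be0; have [n] := ubnP #|Z|; elim: n Z l => // n IH Z l.
rewrite ltnS => Zn ZX big hl.
have l70 : 69 < l.
  case/andP: hl => _ h; have : be.+1 * 70 ^ 2 < be.+1 * l.+1 ^ 2.
    by apply: leq_ltn_trans h; rewrite mulnC -mulnA.
  by rewrite ltn_pmul2l // ltn_exp2r.
have leaf : [\/ #|Z| < 200 * (200 * be.+1), #|Z| < 1000 * (al + 1) * (u Z).+1 | #|Z| <= 60 * pl D Z] ->
    exists zs, [/\ chain D zs,
    forall z, z \in zs -> z \subset Z /\
      [\/ #|z| < 200 * (200 * be.+1), #|z| < 1000 * (al + 1) * (u z).+1 | #|z| <= 60 * pl D z],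
    forall z, z \in zs -> 0 < #|z| &
    #|Z| + 30 * (be.+1 * l) <= 2 * \sum_(z <- zs) #|z|].
  move=> h; exists [:: Z]; split.
  - split=> //; rewrite big_nil; split; last by move=> a b _; rewrite inE.
    by rewrite -setI_eq0 setI0.
  - by move=> z; rewrite inE => /eqP->.
  - by move=> z; rewrite inE => /eqP->; move: big; clear; lia.
  - rewrite big_seq1; case/andP: hl => hl1 _.
    have : be.+1 * (30 * l) <= be.+1 * l ^ 2.
      by rewrite leq_mul2l /= expnS expn1 leq_mul2r (leq_trans _ l70) ?orbT.
    by move: hl1; clear; lia.
have [|b1] := ltnP #|Z| (200 * (200 * be.+1)); first by move=> h; apply: leaf; constructor 1.
have [|b2] := ltnP #|Z| (1000 * (al + 1) * (u Z).+1); first by move=> h; apply: leaf; constructor 2.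
have hJ' J : J \subset Z -> #|J| < #|Z| -> #|J| <= al * u J + be * pl D J.
  move=> JZ lt; apply: hJ (subset_trans JZ ZX) (leq_trans lt (subset_leq_card ZX)).
have [|[U [W [UZ WZ ex U8 [W8 le]]]]] := split_or_path cap hJ' b2 b1 hl be0.
  by move=> h; apply: leaf; constructor 3.
have dUW : #|U| + #|W| <= #|Z|.
  case: ex => dWU _; rewrite -(cardsUI U W) setIC (disjoint_setI0 dWU) cards0 addn0.
  by apply: subset_leq_card; rewrite subUset UZ.
have [l1 hl1] := @scaled_sqrt be.+1 #|U| isT; have [l2 hl2] := @scaled_sqrt be.+1 #|W| isT.
have U0 : #|W| > 0 by move: big W8; clear; lia.
have W0 : #|U| > 0 by move: big U8; clear; lia.
have [||zs1 [c1 h1 p1 s1]] := IH U l1 _ (subset_trans UZ ZX) _ hl1.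
- by move: Zn dUW U0; clear; lia.
- by move: b1 U8; clear; lia.
have [||zs2 [c2 h2 p2 s2]] := IH W l2 _ (subset_trans WZ ZX) _ hl2.
- by move: Zn dUW W0; clear; lia.
- by move: b1 W8; clear; lia.
exists (zs2 ++ zs1); split.
(* The pieces of [W] come first because no edge leads from [U] to [W]. *)
- apply: chain_cat ex => // z; [by case/h2|by case/h1].
- move=> z; rewrite mem_cat => /orP[/h2|/h1] [zs h]; split=> //; exact: subset_trans zs _.
- by move=> z; rewrite mem_cat => /orP[/p2|/p1].
have [hU1 hU2] := andP hl1; have [hW1 hW2] := andP hl2; have [hZ1 hZ2] := andP hl.
have g : 32 * l + 64 <= 30 * (l1.+1 + l2.+1).
  have r0 : 0 < be.+1 by [].
  apply: sqrt_gain.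
  - have : be.+1 * 200 ^ 2 < be.+1 * l.+1 ^ 2.
      by apply: leq_ltn_trans hZ2; rewrite mulnC -mulnA.
    by rewrite ltn_pmul2l // ltn_exp2r // ltnS => /ltnW.
  - rewrite -(leq_pmul2l r0); apply: leq_trans hZ1 _; rewrite mulnCA.
    by apply: leq_trans U8 _; rewrite leq_mul2l ltnW ?orbT.
  - rewrite -(leq_pmul2l r0); apply: leq_trans hZ1 _; rewrite mulnCA.
    by apply: leq_trans W8 _; rewrite leq_mul2l ltnW ?orbT.
  - rewrite -(leq_pmul2l r0); apply: leq_trans hZ1 _; apply: leq_trans le _.
    by rewrite !mulnDr leq_add2r leq_add // ltnW.
rewrite big_cat /= mulnDr; have : be.+1 * (32 * l + 64) <= be.+1 * (30 * (l1.+1 + l2.+1)).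
  by rewrite leq_mul2l g orbT.
move: le s1 s2; move: (\sum_(z <- zs1) _) (\sum_(z <- zs2) _) => S1 S2.
clear; lia.
Qed.

(** The pieces of [decompose] cover at least half of [X], and each satisfies a bound in which [be]
    does not occur; [chain_path] and [chain_capacity] add these bounds up. *)
Lemma size_bound X al be sp su : 0 < be ->
  (forall J, J \subset X -> #|J| < #|X| -> #|J| <= al * u J + be * pl D J) ->
  (forall Z, Z \subset X -> #|Z| < 200 * (200 * be.+1) -> #|Z| <= sp * pl D Z + su * u Z) ->
  #|X| <= 2 * ((60 + sp) * (2 * pl D X + 25 * u X) + (2 * (1000 * (al + 1)) + su) * u X).
Proof.
move=> be0 hJ small; have [H eH] : exists H, H = 2 * (1000 * (al + 1)) by exists (2 * (1000 * (al + 1))).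
rewrite -eH; have [lt|big] := ltnP #|X| (200 * (200 * be.+1)).
  apply: leq_trans (small X (subxx X) lt) _; apply: leq_trans (leq_pmull _ (isT : 0 < 2)).
  by apply: leq_add; apply: leq_mul => //; clear; lia.
have [l hl] := @scaled_sqrt be.+1 #|X| isT.
have [|zs [cz hz pz sz]] := decompose hJ be0 (subxx X) _ hl; first by move: big; clear; lia.
have uz z : z \in zs -> 0 < u z.
  by move=> /pz /card_gt0P[x xz]; case: cap => _ h _ _; apply: h xz.
have cz1 z : z \in zs -> #|z| <= (60 + sp) * pl D z + (H + su) * u z.
  move=> zzs; have u0 := uz z zzs; have [zX [h|h|h]] := hz z zzs.
  - by apply: leq_trans (small z zX h) _; rewrite !mulnDl leq_add // leq_addl.
  - apply: leq_trans (ltnW h) _; apply: leq_trans (leq_addl _ _).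
    rewrite mulnDl; apply: leq_trans (leq_addr _ _).
    rewrite eH -!mulnA (mulnCA 2) leq_mul2l (mulnCA 2) leq_mul2l.
    by move: u0; clear; lia.
  - apply: leq_trans h _; apply: leq_trans (leq_addr _ _).
    by rewrite mulnDl leq_addr.
have : \sum_(z <- zs) #|z| <= (60 + sp) * \sum_(z <- zs) pl D z + (H + su) * \sum_(z <- zs) u z.
  rewrite !big_distrr -big_split /= big_seq [X in _ <= X]big_seq; exact: leq_sum.
have c1 := chain_path cap cz (fun z hzz => (hz z hzz).1).
have c2 := leq_trans (chain_capacity cap cz) (_ : _ <= u X).
have {c2} c2 : \sum_(z <- zs) u z <= u X.
  apply: c2; apply: capacity_mono cap _ _ _; elim: zs hz {cz pz sz uz cz1 c1} => [|z zs IH] hz.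
    by rewrite big_nil sub0set.
  rewrite big_cons subUset IH ?andbT; first by case: (hz z (mem_head _ _)).
  by move=> y hy; apply: hz; rewrite inE hy orbT.
move: sz c1 c2; set P := \sum_(z <- zs) pl D z; set C := \sum_(z <- zs) #|z|; set Uz := \sum_(z <- zs) u z.
move=> sz c1 c2 c3.
have c4 : P <= 2 * pl D X + 25 * u X by move: c1; clear; lia.
have c5 : #|X| <= 2 * C by move: sz; clear; lia.
apply: leq_trans c5 _; rewrite leq_mul2l /=; apply: leq_trans c3 _.
by apply: leq_add; rewrite leq_mul2l ?c4 ?c2 orbT.
Qed.
End Pieces.

(** * Trees as a superadditive functional *)

Fixpoint omap S T (f : S -> T) (t : otree S) : otree T :=
  match t with
  | Vertex a => Vertex (f a)
  | Graft d c r => Graft d (omap f c) (omap f r)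
  end.

Lemma osize_omap S T (f : S -> T) t : osize (omap f t) = osize t.
Proof. by elim: t => //= d c -> r ->. Qed.

Lemma emb_omap V S T (f : S -> T) D t v (U : {set V}) : emb D (omap f t) v U <-> emb D t v U.
Proof.
elim: t v U => //= d c IHc r IHr v U.
by split=> -[w [U1 [U2 [h1 h2 h3 /IHc h4 /IHr h5]]]]; exists w, U1, U2.
Qed.

Lemma universal_tree V D (X : {set V}) m T (t : otree T) : universal D X m -> osize t <= m ->
  exists v U, emb D t v U /\ U \subset X.
Proof.
move=> h sz; have [|v [U [/emb_omap e s]]] := h (omap (fun=> 0) t); last by exists v, U.
by rewrite osize_omap.
Qed.

Lemma emb_omap_eq V S T (t : otree S) (t' : otree T) D v (U : {set V}) :
  omap (fun=> 0) t = omap (fun=> 0) t' -> emb D t v U -> emb D t' v U.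
Proof. by move=> e /(emb_omap (fun=> 0)); rewrite e => /emb_omap. Qed.

Fixpoint oroot T (t : otree T) : T :=
  match t with Vertex a => a | Graft _ _ r => oroot r end.

(* The label [true] marks an initial segment: no edge leads from [false] to [true]. *)
Fixpoint oriented (t : otree bool) : bool :=
  if t is Graft d c r then
    [&& oriented c, oriented r & if d then oroot c ==> oroot r else oroot r ==> oroot c]
  else true.

Fixpoint ocount b (t : otree bool) :=
  match t with Vertex a => nat_of_bool (a == b) | Graft _ c r => ocount b c + ocount b r end.

Lemma const_oriented T (t : otree T) b : let t' := omap (fun=> b) t in
  [/\ omap (fun=> 0) t' = omap (fun=> 0) t, oriented t', oroot t' = b,
      ocount b t' = osize t & ocount (~~ b) t' = 0].
Proof.
elim: t => [a|d c [c1 c2 c3 c4 c5] r [r1 r2 r3 r4 r5]] /=; first by split; case: b.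
by rewrite c1 c2 c3 c4 c5 r1 r2 r3 r4 r5; split=> //; case: d; case: b {c1 c2 c3 c4 c5 r1 r2 r3 r4 r5}.
Qed.

(** Of the two halves of a [Graft], the one at the tail of the joining edge is filled first; only
    when it is full does the other receive labels [true]. *)
Lemma initial_segment T (t : otree T) k : k <= osize t -> exists t' : otree bool,
  [/\ omap (fun=> 0) t' = omap (fun=> 0) t, oriented t',
      ocount true t' = k & ocount false t' = osize t - k].
Proof.
elim: t k => [a|d c IHc r IHr] k /= sz.
  by case: k sz => [|[|//]] _; [exists (Vertex false)|exists (Vertex true)].
case: d.
  have [kr|[kr kc]] : k <= osize r \/ osize r < k /\ k - osize r <= osize c by lia.
    have [r' [h1 h2 h3 h4]] := IHr k kr.
    exists (Graft true (omap (fun=> false) c) r'); have [d1 d2 d3 d4 d5] := const_oriented c false.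
    split=> /=; rewrite ?d1 ?h1 ?d2 ?h2 ?d3 //=; move: d4 d5 => /= d4 d5; rewrite ?d4 ?d5 ?h3 ?h4; lia.
  have [c' [h1 h2 h3 h4]] := IHc _ kc.
  exists (Graft true c' (omap (fun=> true) r)); have [d1 d2 d3 d4 d5] := const_oriented r true.
  split=> /=; rewrite ?d1 ?h1 ?d2 ?h2 ?d3 ?implybT //=; move: d4 d5 => /= d4 d5; rewrite ?d4 ?d5 ?h3 ?h4; lia.
have [kr|[kr kc]] : k <= osize c \/ osize c < k /\ k - osize c <= osize r by lia.
  have [c' [h1 h2 h3 h4]] := IHc k kr.
  exists (Graft false c' (omap (fun=> false) r)); have [d1 d2 d3 d4 d5] := const_oriented r false.
  split=> /=; rewrite ?d1 ?h1 ?d2 ?h2 ?d3 //=; move: d4 d5 => /= d4 d5; rewrite ?d4 ?d5 ?h3 ?h4; lia.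
have [r' [h1 h2 h3 h4]] := IHr _ kc.
exists (Graft false (omap (fun=> true) c) r'); have [d1 d2 d3 d4 d5] := const_oriented c true.
split=> /=; rewrite ?d1 ?h1 ?d2 ?h2 ?d3 ?implybT //=; move: d4 d5 => /= d4 d5; rewrite ?d4 ?d5 ?h3 ?h4; lia.
Qed.

(* The vertices labelled [b], with the components joined up arbitrarily into a tree. *)
Fixpoint part b (t : otree bool) : option (otree bool) :=
  match t with
  | Vertex a => if a == b then Some t else None
  | Graft d c r =>
      match part b c, part b r with
      | Some c', Some r' => Some (Graft d c' r')
      | Some c', None => Some c'
      | None, o => o
      end
  end.

Lemma osize_part b t : (if part b t is Some t' then osize t' else 0) = ocount b t.
Proof.
elim: t => [a|d c IHc r IHr] /=; first by case: eqP.
by move: IHc IHr; case: (part b c) => [c'|]; case: (part b r) => [r'|] /= <- <-; rewrite ?addn0.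
Qed.

Lemma part_root b t : oroot t = b -> part b t <> None.
Proof.
elim: t => [a|d c _ r IHr] /=; first by move=> ->; rewrite eqxx.
by move=> /IHr; case: (part b c) => [c'|]; case: (part b r).
Qed.

Section Superadditivity.
Variables (V : finType) (E : rel V).
Implicit Types (A B U : {set V}).

Definition pemb (o : option (otree bool)) (v : V) U :=
  if o is Some t then emb E t v U else U = set0.

Lemma pemb_root b t v U : oroot t = b -> pemb (part b t) v U -> v \in U.
Proof.
by move=> /part_root; case: (part b t) => //= t' _ /emb_root.
Qed.

Lemma pemb_graft b d c r v U : pemb (part b (Graft d c r)) v U ->
  exists w Uc v' Ur, [/\ pemb (part b c) w Uc, pemb (part b r) v' Ur, U = Uc :|: Ur,
    [disjoint Uc & Ur] & oroot r = b -> v' = v /\ (oroot c = b -> dedge E d v' w)].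
Proof.
have pc := @part_root b c; have pr := @part_root b r; move=> /=.
case: (part b c) pc => [c'|] pc; case: (part b r) pr => [r'|] pr /=.
- by case=> w [U1 [U2 [-> dis Dd e1 e2]]]; exists w, U1, v, U2; split.
- move=> e; exists v, U, v, set0; split=> //; rewrite ?setU0 //.
    by rewrite -setI_eq0 setI0.
  by move=> /pr.
- move=> e; exists v, set0, v, U; split=> //; rewrite ?set0U //.
    by rewrite -setI_eq0 set0I.
  by move=> _; split=> // /pc.
- move=> ->; exists v, set0, v, set0; split=> //; rewrite ?set0U //.
    by rewrite -setI_eq0 set0I.
  by move=> /pr.
Qed.

(** Edges inside a part survive by [pemb_graft]; an edge between the parts goes from [true] to
    [false], that is from [A] to [B], where [E] is complete. *)
Lemma emb_join A B t vA UA vB UB :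
  [disjoint A & B] -> (forall a b, a \in A -> b \in B -> E a b) -> oriented t ->
  pemb (part true t) vA UA -> UA \subset A -> pemb (part false t) vB UB -> UB \subset B ->
  emb E t (if oroot t then vA else vB) (UA :|: UB).
Proof.
move=> dAB cE; elim: t vA UA vB UB => [a|d c IHc r IHr] vA UA vB UB.
  by case: a => /= _ hA sA hB sB; rewrite ?hA ?hB ?setU0 ?set0U.
move=> /and3P[oc or_ od] /pemb_graft[wA [UcA [vA' [UrA [ecA erA -> dA DA]]]]] sA.
move=> /pemb_graft[wB [UcB [vB' [UrB [ecB erB -> dB DB]]]]] sB.
move: sA sB; rewrite !subUset => /andP[scA srA] /andP[scB srB].
have hc := IHc _ _ _ _ oc ecA scA ecB scB; have hr := IHr _ _ _ _ or_ erA srA erB srB.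
have vE : (if oroot r then vA else vB) = (if oroot r then vA' else vB').
  by case: (oroot r) DA DB => DA DB; [case: (DA erefl)|case: (DB erefl)].
rewrite /= vE; exists (if oroot c then wA else wB), (UcA :|: UcB), (UrA :|: UrB); split=> //.
- by rewrite setUACA.
- have sAB (U W : {set V}) : U \subset A -> W \subset B -> [disjoint U & W].
    by move=> sU sW; rewrite (disjointWl sU (disjointWr sW dAB)).
  have dBA : [disjoint UcB & UrA] by rewrite disjoint_sym; exact: sAB.
  by rewrite -setI_eq0 setIUr !setIUl !setU_eq0 !setI_eq0 dA dB dBA (sAB UcA UrB).
- have cA : oroot c = true -> wA \in A by move=> h; apply: (subsetP scA); apply: pemb_root h ecA.
  have rA : oroot r = true -> vA' \in A by move=> h; apply: (subsetP srA); apply: pemb_root h erA.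
  have cB : oroot c = false -> wB \in B by move=> h; apply: (subsetP scB); apply: pemb_root h ecB.
  have rB : oroot r = false -> vB' \in B by move=> h; apply: (subsetP srB); apply: pemb_root h erB.
  move: od DA DB cA rA cB rB; case: (oroot r); case: (oroot c); case: d => //= _ DA DB cA rA cB rB.
  + by case: (DA erefl) => _ ->.
  + by case: (DA erefl) => _ ->.
  + by apply: cE; [exact: rA|exact: cB].
  + by apply: cE; [exact: cA|exact: rB].
  + by case: (DB erefl) => _ ->.
  + by case: (DB erefl) => _ ->.
Qed.

(** The tree is cut into an initial segment with at most [a] vertices and a rest with at most [b].
    Each is completed to a tree by [part] and embedded on its own side. *)
Lemma universal_join A B a b :
  [disjoint A & B] -> (forall x y, x \in A -> y \in B -> E x y) ->
  universal E A a -> universal E B b -> universal E (A :|: B) (a + b).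
Proof.
move=> dAB cE uA uB t sz.
have [t' [sh ot cT cF]] := initial_segment (geq_minr a (osize t)).
have [x0 _] : exists x0, x0 \in A :|: B.
  apply/card_gt0P; have := osize_gt0 t; have ca := universal_card uA; have cb := universal_card uB.
  by rewrite cardsU (disjoint_setI0 dAB) cards0; lia.
have pick b' (X : {set V}) m : universal E X m -> ocount b' t' <= m ->
    exists v U, pemb (part b' t') v U /\ U \subset X.
  rewrite -osize_part => uX; case: (part b' t') => [t''|] le.
    exact: universal_tree uX le.
  by exists x0, set0; rewrite sub0set.
have [|vA [UA [eA sA]]] := pick true A a uA; first by rewrite cT geq_minl.
have [|vB [UB [eB sB]]] := pick false B b uB; first by rewrite cF; move: sz; clear; lia.
exists (if oroot t' then vA else vB), (UA :|: UB); split; last exact: setUSS.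
exact: emb_omap_eq sh (emb_join dAB cE ot eA sA eB sB).
Qed.

(** Classical decidability turns the proposition [universal] into a condition for a maximum;
    [universal_card] justifies the range. *)
Definition unum (X : {set V}) :=
  \max_(m < #|V|.+1 | if excluded_middle_informative (universal E X m) then true else false) m.

Lemma unum_ge X m : universal E X m -> m <= unum X.
Proof.
move=> h; have lt : m < #|V|.+1 by rewrite ltnS (leq_trans (universal_card h)) ?max_card.
apply: (@leq_bigmax_cond _ _ (fun i : 'I_#|V|.+1 => val i) (Ordinal lt)) => /=.
by case: excluded_middle_informative.
Qed.

Lemma universal_unum X : universal E X (unum X).
Proof.
rewrite /unum; elim/big_ind: _ => [|m n hm hn|i]; first exact: universal0.
  by rewrite /maxn; case: ifP.
by case: excluded_middle_informative.
Qed.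

End Superadditivity.

Section Capacities.
Variables (V : finType) (D : rel V).
Implicit Types (X Y : {set V}).

Lemma dualK : dual (dual D) = D.
Proof. by apply: functional_extensionality => x; apply: functional_extensionality => y; rewrite /dual negbK. Qed.

Lemma unum_mono X Y : X \subset Y -> unum D X <= unum D Y.
Proof. by move=> s; apply: unum_ge; apply: universal_sub s (@universal_unum _ _ _). Qed.

Lemma capacity_pl : capacity D (pl (dual D)).
Proof.
split=> [A B|x A|A B|t Y]; [exact: pl_mono|exact: pl_pos| |exact: dense_pl].
move=> dAB ex; have [s [<- us ss sA]] := pl_path (leqnn (pl (dual D) A)).
have [t [<- ut st tB]] := pl_path (leqnn (pl (dual D) B)).
rewrite -size_cat; apply: pl_geP.
- rewrite cat_uniq us ut andbT; apply/hasPn => x /tB xB; apply/negP => /sA xA.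
  by move/pred0P: dAB => /(_ x) /=; rewrite xA xB.
- case: s us ss sA => //= a s us ss sA; rewrite cat_path ss /=.
  case: t ut st tB => //= b t ut st tB; rewrite st andbT.
  by apply: ex; [apply: sA; apply: mem_last|apply: tB; apply: mem_head].
- by move=> x; rewrite mem_cat inE => /orP[/sA->|/tB->]; rewrite ?orbT.
Qed.

Lemma capacity_unum : capacity D (unum (dual D)).
Proof.
split=> [A B s|x A xA|A B dAB ex|t Y /dense_universal h].
- by apply: unum_ge; apply: universal_sub s (@universal_unum _ _ _).
- exact/unum_ge/universal1/xA.
- by apply: unum_ge; apply: universal_join; [exact: dAB|exact: ex|exact: (@universal_unum _ _ _)|exact: (@universal_unum _ _ _)].
- exact: unum_ge.
Qed.

(** The labels of [forward_labels] take at most [pl D X] values on [X]. A class of equal labels has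
    no forward edge of [D], so read backwards it is a path of [dual D]. *)
Lemma size_le_mul X : #|X| <= pl D X * pl (dual D) X.
Proof.
have [l [l1 l2]] := forward_labels D (enum_uniq X).
have lp x : x \in X -> l x <= pl D X.
  rewrite -mem_enum => /l1[t [ut st sub ->]]; rewrite -(size_rcons t x).
  by apply: pl_geP => // y /sub; rewrite mem_enum.
have cls a : #|[set x in X | l x == a]| <= pl (dual D) X.
  pose s := filter (fun x => l x == a) (enum X).
  have us : uniq s by apply: filter_uniq; apply: enum_uniq.
  have -> : #|[set x in X | l x == a]| = size (rev s).
    rewrite size_rev -(card_uniqP us); apply: eq_card => x.
    by rewrite inE mem_filter mem_enum andbC.
  apply: pl_geP; rewrite ?rev_uniq //; last first.
    by move=> x; rewrite mem_rev mem_filter mem_enum => /andP[].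
  rewrite rev_sorted; have : pairwise (before (enum X)) s.
    exact: subseq_pairwise (filter_subseq _ _) (pairwise_before (enum_uniq _)).
  move=> /pairwise_sorted; apply: sub_in_sorted (_ : all [in s] s); last exact/allP.
  have sP z : z \in s -> l z = a /\ z \in enum X by rewrite mem_filter => /andP[/eqP].
  move=> x y /sP[lx xX] /sP[ly yX] b.
  by apply/negP => /(l2 _ _ xX yX b); rewrite lx ly ltnn.
rewrite -sum1_card.
have -> : \sum_(x in X) 1 = \sum_(a < (pl D X).+1) \sum_(x in X | l x == a) 1.
  rewrite (exchange_big_dep (mem X)) /=; last by move=> i x _ /andP[].
  apply: eq_bigr => x xX; have lt : l x < (pl D X).+1 by rewrite ltnS lp.
  by rewrite (big_pred1 (Ordinal lt)) // => i; rewrite xX /= eq_sym.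
rewrite big_ord_recl /= big1 ?add0n => [|x]; last first.
  by move=> /andP[xX /eqP l0]; move: xX; rewrite -mem_enum => /l1[t [_ _ _]]; rewrite l0.
apply: leq_trans (_ : \sum_(i < pl D X) pl (dual D) X <= _); last by rewrite sum_nat_const card_ord.
by apply: leq_sum => i _; rewrite sum1dep_card; apply: cls.
Qed.
End Capacities.

(** * The bounds for paths and trees *)

(** [K] absorbs the numerical constants, including [be + 1 <= 2 * be] in the size of small sets. *)
Lemma size_bound_uniform : exists K, 0 < K /\
  forall (V : finType) (D : rel V) u (X : {set V}) al be sp su, capacity D u -> 0 < be ->
  (forall J : {set V}, J \subset X -> #|J| < #|X| -> #|J| <= al * u J + be * pl D J) ->
  (forall Z : {set V}, Z \subset X -> #|Z| <= K * be -> #|Z| <= sp * pl D Z + su * u Z) ->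
  #|X| <= K * ((1 + sp) * pl D X + (al + sp + su + 1) * u X).
Proof.
have [K eK] : exists K, K = 200 * (200 * 2) by exists (200 * (200 * 2)).
exists K; split=> [|V D u X al be sp su cap be0 hJ small]; first by rewrite eK.
have small' (Z : {set V}) : Z \subset X -> #|Z| < 200 * (200 * be.+1) -> #|Z| <= sp * pl D Z + su * u Z.
  move=> ZX lt; apply: small ZX (leq_trans (ltnW lt) _).
  by rewrite eK -!mulnA !leq_mul2l /=; move: be0; clear; lia.
apply: leq_trans (size_bound cap be0 hJ small') _.
have -> : 2 * ((60 + sp) * (2 * pl D X + 25 * u X) + (2 * (1000 * (al + 1)) + su) * u X) =
  (4 * (60 + sp)) * pl D X + (50 * (60 + sp) + 4 * (1000 * (al + 1)) + 2 * su) * u X.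
  move: (pl D X) (u X) (1000 * (al + 1)) => p v H; clear; lia.
have k7 : 7 * 1000 <= K.
  by rewrite eK; clear; lia.
rewrite [X in _ <= X]mulnDr (mulnA K) (mulnA K); apply: leq_add; rewrite leq_mul2r; apply/orP; right.
  by apply: leq_trans (_ : 7 * 1000 * (1 + sp) <= _); [clear; lia|rewrite leq_mul2r k7 orbT].
apply: leq_trans (_ : 7 * 1000 * (al + sp + su + 1) <= _); [clear; lia|by rewrite leq_mul2r k7 orbT].
Qed.

(** Bootstrapping: starting from the inductive coefficient [h] for both colours, a first use of the
    size bound makes the coefficient of [pl D] absolute, and a second one, for [dual D], that of the
    other colour. *)
Lemma path_path : exists h, 0 < h /\ forall (V : finType) (D : rel V) (X : {set V}),
  #|X| <= h * (pl D X + pl (dual D) X).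
Proof.
have [K [K0 sb]] := size_bound_uniform.
have [M eM] : exists M, M = K * (K * (K + 2)) * (K * (K + 3)) by eexists.
have [s es] : exists s, s = (M * M).+1 by eexists.
have [h eh] : exists h, h = K * (K + 2 * s + 1) by eexists.
have h0 : 0 < h by rewrite eh muln_gt0 K0; clear; lia.
exists h; split=> // V D X.
have [n] := ubnP #|X|; elim: n D X => // n IH D X; rewrite ltnS => Xn.
have [->|X0] := eqVneq X set0; first by rewrite cards0.
have first_bound (Y : {set V}) : Y \subset X -> #|Y| <= K * pl D Y + K * (K + 2) * h * pl (dual D) Y.
  move=> YX; have YX' := subset_leq_card YX.
  apply: leq_trans (sb V D _ Y h h 0 (K * h) (capacity_pl D) h0 _ _) _ => [J JY lt|Z ZY le|].
  - by rewrite -mulnDr addnC; apply: IH; apply: leq_trans Xn; apply: leq_trans lt YX'.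
  - rewrite mul0n add0n; have [->|/set0Pn[z zZ]] := eqVneq Z set0; first by rewrite cards0.
    by apply: leq_trans le _; rewrite leq_pmulr // (pl_pos _ zZ).
  rewrite addn0 mul1n mulnDr leq_add2l mulnA leq_mul2r.
  apply/orP; right; rewrite -mulnA leq_mul2l addn0; apply/orP; right.
  by move: h0; clear; lia.
have b0 : 0 < K * (K + 2) * h by rewrite !muln_gt0 K0 h0 addn2.
have cap2 : capacity (dual D) (pl D) by have := capacity_pl (dual D); rewrite dualK.
apply: leq_trans (sb V (dual D) _ X K _ s s cap2 b0 _ _) _ => [J JX lt|Z ZX le|].
- exact: first_bound.
(* The bound on [#|Z|] is at most [M * s]. Either the two path lengths add up to at least [M], and
   [s] times their sum suffices, or [size_le_mul] bounds [#|Z|] by [s]. *)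
- have [big|small] := leqP M (pl D Z + pl (dual D) Z).
    apply: leq_trans le _; rewrite -mulnDr (addnC (pl (dual D) Z)); apply: leq_trans (_ : M * s <= _).
      rewrite mulnA eM -[X in _ <= X]mulnA leq_mul2l; apply/orP; right.
      rewrite eh -mulnA leq_mul2l; apply/orP; right.
      have : 0 < s by rewrite es.
      by move: (s) => s1; clear; nia.
    by rewrite mulnC leq_mul2l big orbT.
  have [->|/set0Pn[z zZ]] := eqVneq Z set0; first by rewrite cards0.
  rewrite -mulnDr; apply: leq_trans (_ : s <= _).
    apply: leq_trans (size_le_mul D Z) _; rewrite es; apply: leqW; apply: leq_mul; move: small; clear; lia.
  by rewrite leq_pmulr // addn_gt0 (pl_pos _ zZ).
rewrite eh -mulnA leq_mul2l; apply/orP; right.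
by move: (pl D X) (pl (dual D) X) (s) => p p' s'; clear; nia.
Qed.

Lemma exp_beats_quadratic c : exists q, c * (2 * q + 3) ^ 2 <= 2 ^ q.
Proof.
have [k ek] : exists k, k = 36 * c by eexists.
(* [2 ^ (3 k)] is [2 ^ k] times its square: the first factor exceeds [36 c], the second accounts for
   the quadratic term. *)
exists (3 * k).
have le : 2 * (3 * k) + 3 <= 6 * 2 ^ k by have := ltn_expl k (isT : 1 < 2); move: (2 ^ k); clear; lia.
apply: leq_trans (_ : c * (6 * 2 ^ k) ^ 2 <= _); first by rewrite leq_mul2l leq_exp2r ?le ?orbT.
rewrite expnMn (mulnCA c) mulnA (_ : 6 ^ 2 * c = k) //.
rewrite (mulnC 3) expnM !expnS !expn0 !muln1 leq_mul2r; apply/orP; right.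
exact: ltnW (ltn_expl _ _).
Qed.

(** By [first_bound], sets of [(K + 1) * N] vertices contain in [dual D] all trees with [N / 2 ^ q]
    vertices: [h] is linear in [q], so [2 ^ q] outweighs the coefficient [K * (K + 2) * h]. Then
    [dual D] is universal for [N] on [X], and [N] was chosen too large for that. *)
Lemma path_tree : exists h, 0 < h /\ forall (V : finType) (D : rel V) (X : {set V}),
  #|X| <= h * (pl D X + unum (dual D) X).
Proof.
have [K [K0 sb]] := size_bound_uniform; have [g [g0 pp]] := path_path.
have [G eG] : exists G, G = 4 * (12 * g + K + 47) by eexists.
have [q qe] := exp_beats_quadratic (K * (K + 2) * G).
have [h eh] : exists h, h = (2 * q + 3) * G by eexists.
have G0 : 0 < G by rewrite eG; clear; lia.
have h0 : 0 < h by rewrite eh muln_gt0 G0; clear; lia.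
have hq : K * (K + 2) * h <= 2 ^ q.
  apply: leq_trans qe; rewrite eh (mulnC _ G) mulnA leq_mul2l; apply/orP; right.
  by rewrite expnS expn1 leq_pmulr // addn3.
exists h; split=> // V D X.
have [n] := ubnP #|X|; elim: n D X => // n IH D X; rewrite ltnS => Xn.
have [->|/set0Pn[x0 x0X]] := eqVneq X set0; first by rewrite cards0.
have first_bound (Y : {set V}) : Y \subset X ->
    #|Y| <= K * pl D Y + K * (K + 2) * h * unum (dual D) Y.
  move=> YX; have YX' := subset_leq_card YX.
  apply: leq_trans (sb V D _ Y h h 0 (K * h) (capacity_unum D) h0 _ _) _ => [J JY lt|Z ZY le|].
  - by rewrite -mulnDr addnC; apply: IH; apply: leq_trans Xn; apply: leq_trans lt YX'.
  - rewrite mul0n add0n; have [->|/set0Pn[z zZ]] := eqVneq Z set0; first by rewrite cards0.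
    by apply: leq_trans le _; rewrite leq_pmulr //; apply: unum_ge; apply: universal1 zZ.
  rewrite addn0 mul1n mulnDr leq_add2l mulnA leq_mul2r.
  apply/orP; right; rewrite -mulnA leq_mul2l addn0; apply/orP; right.
  by move: h0; clear; lia.
set p := pl D X; set v := unum (dual D) X; pose N := (maxn p v).+1.
have p0 : 0 < p by apply: pl_pos x0X.
have Nle : N <= 2 * (p + v) by rewrite /N; move: p0; clear; lia.
pose m := N %/ 2 ^ q.
rewrite leqNgt; apply/negP => big.
have : universal (dual D) X N.
  apply: (@universal_of_small_trees _ _ X N q (2 * g * N) m ((K + 1) * N) ((12 * g + K + 47) * N)).
  - move=> Y YX; rewrite dualK; apply/negP => /dense_pl; rewrite leqNgt /N ltnS.
    by rewrite (leq_trans (pl_mono _ YX)) // leq_maxl.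
  - move=> Y YX cY; apply: haspath_le (plP _ _); rewrite leqNgt; apply/negP => small.
    have := leq_trans cY (pp V D Y); rewrite leqNgt => /negP; apply.
    have pN : pl D Y < N by rewrite ltnS (leq_trans (pl_mono _ YX)) // leq_maxl.
    rewrite (mulnC 2) -mulnA ltn_pmul2l //; move: pN small; clear; lia.
  - move=> Y YX cY; apply: universal_le (@universal_unum _ _ _); rewrite leqNgt; apply/negP => small.
    have := leq_trans cY (first_bound Y YX); rewrite leqNgt => /negP; apply.
    have pN : pl D Y < N by rewrite ltnS (leq_trans (pl_mono _ YX)) // leq_maxl.
    have a1 : K * pl D Y < K * N by rewrite ltn_pmul2l.
    have a2 : K * (K + 2) * h * unum (dual D) Y <= N.
      apply: leq_trans (_ : 2 ^ q * m <= _); first by apply: leq_mul hq (ltnW small).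
      by rewrite mulnC leq_trunc_div.
    by rewrite mulnDl mul1n -addSn leq_add.
  - by rewrite mulnC ltn_ceil // expn_gt0.
  - by rewrite !mulnDl; have := leq_addr; clear; nia.
  - by rewrite !mulnDl; clear; nia.
  - apply: leq_trans (ltnW big); rewrite eh eG.
    rewrite -!mulnA (mulnCA 2) leq_mul2l; apply/orP; right.
    by rewrite mulnC -!mulnA (mulnCA 4); move: Nle; clear; nia.
by move/unum_ge; rewrite leqNgt /N ltnS leq_maxr.
Qed.

(** Two scales: either all large subsets are universal in [D] for trees with [m] vertices, or some
    large [Y] is not, and then by induction all [N]-subsets of [Y] are so in [dual D]. In either
    case small trees yield trees with [N] vertices. The two nested layerings cost the factor [Q ^ 2]
    in [c]. *)
Lemma tree_tree : exists c, forall (V : finType) (D : rel V) (X : {set V}),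
  #|X| <= c * (unum D X + unum (dual D) X).
Proof.
have [g [g0 pt]] := path_tree; have [G eG] : exists G, G = 12 * g + 46 by eexists.
have [q qe] := exp_beats_quadratic (24 * G).
have [Q eQ] : exists Q, Q = 2 * q + 3 by eexists.
have [c ec] : exists c, c = 12 * G * Q ^ 2 by eexists.
have cq : 2 * c <= 2 ^ q by apply: leq_trans qe; rewrite ec eQ -mulnA mulnA; clear; lia.
have Q0 : 0 < Q by rewrite eQ addn3.
have G0 : 0 < G by rewrite eG; clear; lia.
exists c => V D X.
have [n] := ubnP #|X|; elim: n V D X => // n IH V D X; rewrite ltnS => Xn.
have [->|/set0Pn[x0 x0X]] := eqVneq X set0; first by rewrite cards0.
set u1 := unum D X; set u2 := unum (dual D) X; pose N := (maxn u1 u2).+1.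
have u0 : 0 < u1 by apply: unum_ge; apply: universal1 x0X.
have Nle : N <= 2 * (u1 + u2) by rewrite /N; move: u0; clear; lia.
pose m := N %/ 2 ^ q; have mN : m * 2 ^ q <= N := leq_trunc_div _ _.
have Nm : N < 2 ^ q * m.+1 by rewrite mulnC ltn_ceil // expn_gt0.
rewrite leqNgt; apply/negP => big.
have bigN : 6 * Q * (G * Q * N) < #|X|.
  apply: leq_ltn_trans big; apply: leq_trans (_ : c * (u1 + u2) * 1 <= _); last by rewrite muln1.
  rewrite ec; apply: leq_trans (_ : 6 * G * Q ^ 2 * (2 * (u1 + u2)) <= _); last first.
    by rewrite (mulnCA _ 2) muln1; clear; lia.
  apply: leq_trans (_ : 6 * G * Q ^ 2 * N <= _); last by rewrite leq_mul2l Nle orbT.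
  by rewrite expnS expn1; clear; lia.
have nd1 (Y : {set V}) : Y \subset X -> ~~ dense D N Y.
  move=> YX; apply/negP => /dense_universal/unum_ge; rewrite leqNgt /N ltnS.
  by rewrite (leq_trans (unum_mono _ YX)) // leq_maxl.
have nd2 (Y : {set V}) : Y \subset X -> ~~ dense (dual D) N Y.
  move=> YX; apply/negP => /dense_universal/unum_ge; rewrite leqNgt /N ltnS.
  by rewrite (leq_trans (unum_mono _ YX)) // leq_maxr.
have paths (D' : rel V) (Y : {set V}) : unum (dual D') Y < N -> 2 * g * N <= #|Y| -> haspath D' Y N.
  move=> uN cY; apply: haspath_le (plP _ _); rewrite leqNgt; apply/negP => small.
  have := leq_trans cY (pt V D' Y); rewrite leqNgt => /negP; apply.
  by rewrite (mulnC 2) -mulnA ltn_pmul2l //; move: uN small; clear; lia.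
have paths1 (Y : {set V}) : Y \subset X -> 2 * g * N <= #|Y| -> haspath D Y N.
  by move=> YX; apply: paths; rewrite ltnS (leq_trans (unum_mono _ YX)) // leq_maxr.
have paths2 (Y : {set V}) : Y \subset X -> 2 * g * N <= #|Y| -> haspath (dual D) Y N.
  by move=> YX; apply: paths; rewrite dualK ltnS (leq_trans (unum_mono _ YX)) // leq_maxl.
have [[Y [YX cY nu]]|all_universal] := classic (exists Y : {set V},
    [/\ Y \subset X, 2 * (Q * (G * N)) <= #|Y| & ~ universal D Y m]).
  suff : universal (dual D) Y N.
    by move=> /(universal_sub YX)/unum_ge; rewrite leqNgt /N ltnS leq_maxr.
  rewrite eQ in cY; apply: (universal_of_small_trees (kappa := 2 * g * N) (W := G * N) (m := m) (w0 := N) _ _ _ Nm _ _ cY).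
  - by move=> Z ZY; rewrite dualK; apply: nd1 (subset_trans ZY YX).
  - by move=> Z ZY; apply: paths2 (subset_trans ZY YX).
  - move=> Z ZY cZ; have [Z' [Z'Z cZ']] : exists Z' : {set V}, Z' \subset Z /\ #|Z'| = N.
      have /card_geqP[s [us ss sZ]] := cZ; exists [set x in s]; split.
        by apply/subsetP => x; rewrite inE => /sZ.
      by rewrite cardsE (card_uniqP us).
    apply: (universal_sub Z'Z); apply: universal_le (@universal_unum _ _ _); rewrite leqNgt; apply/negP => small.
    have small1 : unum D Z' < m.
      rewrite ltnNge; apply/negP => le; apply: nu; apply: universal_sub (subset_trans Z'Z ZY) _.
      exact: universal_le le (@universal_unum _ _ _).
    have /IH : #|Z'| < n.
      rewrite cZ'; apply: leq_trans Xn; apply: leq_ltn_trans bigN.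
      by rewrite (mulnA (6 * Q)) leq_pmull // !muln_gt0 Q0 G0.
    rewrite cZ' => /(_ D) NZ.
    (* With both numbers below [m] the induction hypothesis gives
       [N < 2 * c * m <= 2 ^ q * m <= N]. *)
    have : N < N.
      apply: leq_ltn_trans NZ _; apply: leq_trans mN; apply: leq_trans (_ : m * (2 * c) <= _); last first.
        by rewrite leq_mul2l cq orbT.
      have c0 : 0 < c by rewrite ec !muln_gt0 G0 Q0.
      by rewrite mulnA (mulnC _ c) ltn_pmul2l //; move: small small1; clear; lia.
    by rewrite ltnn.
  - by rewrite eG; have : 0 < N by []; move: (N) => N1; clear; nia.
  - by rewrite eG; move: (N) => N1; clear; nia.
suff : universal D X N by move=> /unum_ge; rewrite leqNgt /N ltnS leq_maxl.
apply: (universal_of_small_trees (kappa := 2 * g * N) (m := m) (w0 := 2 * (Q * (G * N)))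
   (W := 3 * (G * Q * N)) _ _ _ Nm) => //.
- by move=> Y YX cY; apply: NNPP => nu; apply: all_universal; exists Y.
- apply: leq_trans (_ : G * N <= _); first by rewrite eG; have : 0 < N by []; move: (N) => N1; clear; nia.
  by rewrite (mulnA 3) leq_mul2r mulnCA leq_pmulr ?orbT // muln_gt0 Q0.
- have : 5 * N <= G * Q * N by rewrite leq_mul2r eG; move: Q0; clear; nia.
  by clear; lia.
- by rewrite -eQ; apply: leq_trans (ltnW bigN); clear; lia.
Qed.

(** * From oriented trees to rooted terms *)

Fixpoint leaves T (t : otree T) : seq T :=
  match t with Vertex a => [:: a] | Graft _ c r => leaves c ++ leaves r end.

Fixpoint edges T (t : otree T) : seq (T * T) :=
  match t with
  | Vertex _ => [::]
  | Graft d c r =>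
      (if d then (oroot r, oroot c) else (oroot c, oroot r)) :: edges c ++ edges r
  end.

Lemma size_leaves T (t : otree T) : size (leaves t) = osize t.
Proof. by elim: t => //= d c <- r <-; rewrite size_cat. Qed.

Section Conversion.
Variables V W : finType.

Lemma root_leaf (t : otree V) : oroot t \in leaves t.
Proof. by elim: t => [a|d c _ r h] /=; rewrite ?mem_head // mem_cat h orbT. Qed.

Lemma edges_leaves (t : otree V) x y : (x, y) \in edges t -> (x \in leaves t) && (y \in leaves t).
Proof.
elim: t => //= d c IHc r IHr; rewrite inE !mem_cat => /orP[/eqP|/orP[/IHc|/IHr]].
- by case: d => -[-> ->]; rewrite !root_leaf ?orbT.
- by case/andP=> -> ->.
- by case/andP=> -> ->; rewrite !orbT.
Qed.

Lemma emb_fun (D : rel W) (t : otree V) v U : uniq (leaves t) -> emb D t v U ->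
  exists f : V -> W, [/\ {in leaves t &, injective f}, f (oroot t) = v,
    forall x, x \in leaves t -> f x \in U & forall x y, (x, y) \in edges t -> D (f x) (f y)].
Proof.
elim: t v U => [a|d c IHc r IHr] v U /=.
  move=> _ ->; exists (fun=> v); split=> //.
    by move=> x y; rewrite !inE => /eqP-> /eqP->.
  by move=> x _; rewrite inE.
rewrite cat_uniq => /and3P[uc /hasPn dcr ur] [w [U1 [U2 [-> dis Dd ec er]]]].
have [f [f1 f2 f3 f4]] := IHc _ _ uc ec; have [g [g1 g2 g3 g4]] := IHr _ _ ur er.
pose F x := if x \in leaves c then f x else g x.
have Ff x : x \in leaves c -> F x = f x by rewrite /F => ->.
have Fg x : x \in leaves r -> F x = g x by rewrite /F => /dcr /= /negPf ->.
have sep x y : x \in leaves c -> y \in leaves r -> f x <> g y.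
  by move=> /f3 h1 /g3 h2 e; move/pred0P: dis => /(_ (f x)) /=; rewrite h1 e h2.
exists F; split.
- move=> x y; rewrite !mem_cat => /orP[xc|xr] /orP[yc|yr].
  + by rewrite !Ff //; apply: f1.
  + by rewrite Ff // Fg // => /sep; case.
  + by rewrite Fg // Ff // => /esym /sep; case.
  + by rewrite !Fg //; apply: g1.
- by rewrite Fg ?root_leaf.
- by move=> x; rewrite mem_cat inE => /orP[h|h]; rewrite ?(Ff _ h) ?(Fg _ h) ?f3 ?g3 ?orbT.
- move=> x y; rewrite inE mem_cat => /or3P[|h|h].
  + by case: d Dd => Dd /eqP[-> ->]; rewrite (Ff (oroot c)) ?(Fg (oroot r)) ?root_leaf // f2 g2.
  + by case/andP: (edges_leaves h) => hx hy; rewrite !Ff // f4.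
  + by case/andP: (edges_leaves h) => hx hy; rewrite !Fg // g4.
Qed.

Variable e : rel V.
Hypotheses (irr : forall x, ~~ e x x) (asym : forall x y, e x y -> ~~ e y x)
  (acyc : ug_acyclic e).
Implicit Types A : {set V}.

Definition inside A : rel V := fun x y => [&& undirected e x y, x \in A & y \in A].

Lemma inside_path A x p : path (inside A) x p -> path (undirected e) x p && all (mem A) p.
Proof. by elim: p x => //= y p IH x /andP[/and3P[-> _ ->] /IH]. Qed.

Lemma path_inside A x p : x \in A -> path (undirected e) x p -> all (mem A) p -> path (inside A) x p.
Proof.
elim: p x => //= y p IH x xA /andP[exy ep] /andP[yA pA].
by rewrite /inside exy xA yA /= -/(inside A) IH.
Qed.

(** The component [A1] of a neighbour [w] of the root in [A :\ r] becomes a grafted child, and the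
    rest [A2] keeps the root [r]. *)
Lemma tree_of_connected A r : r \in A -> (forall x, x \in A -> connect (inside A) r x) ->
  exists t, [/\ oroot t = r, uniq (leaves t), leaves t =i A &
    forall x y, x \in A -> y \in A -> e x y -> (x, y) \in edges t].
Proof.
have [n] := ubnP #|A|; elim: n A r => // n IH A r; rewrite ltnS => An rA conn.
have [Ar|] := eqVneq (A :\ r) set0.
  have A1 x : x \in A -> x = r.
    move=> xA; apply/eqP/negPn/negP => xr; have : x \in A :\ r by rewrite !inE xr.
    by rewrite Ar inE.
  exists (Vertex r); split=> //.
    by move=> x; rewrite inE; apply/eqP/idP => [->|/A1].
  by move=> x y /A1-> /A1->; rewrite (negPf (irr r)).
case/set0Pn=> z; rewrite !inE => /andP[zr zA].
have [w [wA rw]] : exists w, w \in A :\ r /\ undirected e r w.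
  have /connectP[[|w p] /=] := conn z zA; first by move=> _ ez; rewrite ez eqxx in zr.
  case/andP=> /and3P[erw _ wA] _ _; exists w; split=> //; rewrite !inE wA andbT.
  by apply/eqP => wr; move: erw; rewrite wr /undirected (negPf (irr r)).
pose A1 := [set y in A :\ r | connect (inside (A :\ r)) w y].
pose A2 := A :\: A1.
have w1 : w \in A1 by rewrite inE wA connect0.
have r1 : r \notin A1 by rewrite !inE eqxx.
have A1A : A1 \subset A by apply/subsetP => y; rewrite !inE => /andP[/andP[_ ->]].
have closed1 y x : y \in A1 -> x \in A :\ r -> connect (inside (A :\ r)) y x -> x \in A1.
  rewrite [y \in A1]inE => /andP[_ wy] xA yx; by rewrite inE xA (connect_trans wy yx).
have conn1 x : x \in A1 -> connect (inside A1) w x.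
  rewrite inE => /andP[_ /connectP[p pp ->]]; apply/connectP; exists p => //.
  have /andP[up pA] := inside_path pp; apply: path_inside => //.
  apply/allP => y yp; have yA := allP pA y yp; apply: closed1 w1 yA _.
  case/splitPr: yp pp => p1 p2; rewrite cat_path => /and3P[h1 h2 _].
  by apply/connectP; exists (rcons p1 y); rewrite ?last_rcons // rcons_path h1.
have conn2 x : x \in A2 -> connect (inside A2) r x.
  rewrite inE => /andP[x1 xA]; have /connectP[p pp ex] := conn x xA.
  case/shortenP: pp ex => p' pp /= /andP[rp up] _ ex; apply/connectP; exists p' => //.
  have /andP[ue pA] := inside_path pp.
  have pA' : all (mem (A :\ r)) p'.
    apply/allP => y yp; rewrite /= !inE; apply/andP; split; last exact: (allP pA y yp).
    by apply: contraNneq rp => <-.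
  apply: (path_inside _ ue); first by rewrite inE r1.
  apply/allP => y yp; rewrite /= [_ \in A2]inE; apply/andP; split; last exact: (allP pA y yp).
  apply: contra x1 => y1.
  have xA' : x \in A :\ r.
    by rewrite ex; case: (p') yp pA' => // b p2 _ /allP h; exact: (h _ (mem_last b p2)).
  apply: closed1 y1 xA' _; move: ue pA' ex; case/splitPr: yp => p1 p2.
  rewrite cat_path all_cat last_cat /= => /and3P[_ _ u2] /and3P[_ yA' a2] ->.
  by apply/connectP; exists p2 => //; apply: path_inside.
have lt1 : #|A1| < n.
  apply: leq_trans An; apply: proper_card; rewrite properE A1A.
  by apply/subsetPn; exists r.
have lt2 : #|A2| < n.
  apply: leq_trans An; apply: proper_card; rewrite properE subsetDl.
  apply/subsetPn; exists w; first exact: (subsetP A1A).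
  by rewrite inE w1.
have r2 : r \in A2 by rewrite inE r1.
have [tc [rc uc lc ec]] := IH A1 w lt1 w1 conn1.
have [tr [rr ur lr er]] := IH A2 r lt2 r2 conn2.
(* An edge from [A1] to a vertex of [A2] other than [r] would stay inside the component, and one
   from [r] to a vertex of [A1] other than [w] would close a cycle. *)
have cross a b : a \in A1 -> b \in A2 -> undirected e a b -> a = w /\ b = r.
  move=> a1 b2 eab; have br : b = r.
    apply/eqP/negPn/negP => br; move: b2; rewrite inE => /andP[/negP b1 bA]; apply: b1.
    have bA' : b \in A :\ r by rewrite !inE br.
    apply: (closed1 a b a1 bA'); apply: connect1; rewrite /inside eab bA' andbT /=.
    by case/setIdP: a1.
  split=> //; apply/eqP/negPn/negP => aw.
  move: a1; rewrite inE => /andP[aA /connectP[p pp ea]].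
  case/shortenP: pp ea => p' pp up _ ea; have /andP[ue pA] := inside_path pp.
  have := @acyc (r :: w :: p'); rewrite /= => /(_ _ _)/negP; apply.
  - apply/andP; split=> //; rewrite inE negb_or; apply/andP; split.
      by move: wA; rewrite !inE eq_sym => /andP[].
    by apply/negP => /(allP pA) /=; rewrite !inE eqxx.
  - by case: (p') ea => //= ea; rewrite ea eqxx in aw.
  - by rewrite rw rcons_path ue -ea -br.
exists (Graft (e r w) tc tr); split=> //=.
- rewrite cat_uniq uc ur andbT; apply/hasPn => x; rewrite lr inE => /andP[x1 _] /=.
  by rewrite lc.
- move=> x; rewrite mem_cat lc lr [x \in A2]inE; case: (boolP (x \in A1)) => //= x1.
  by rewrite (subsetP A1A).
have side x : x \in A -> x \in A1 \/ x \in A2.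
  by move=> xA; rewrite [x \in A2]inE xA andbT; case: (x \in A1); [left|right].
move=> x y /side[x1|x2] /side[y1|y2] exy; rewrite inE mem_cat rc rr.
- by rewrite ec // orbT.
- have [xw yr] : x = w /\ y = r by apply: cross => //; rewrite /undirected exy.
  by move: exy; rewrite xw yr => /asym /negPf ->; rewrite eqxx.
- have [yw xr] : y = w /\ x = r by apply: cross => //; rewrite /undirected exy orbT.
  by move: exy; rewrite xr yw => ->; rewrite eqxx.
- by rewrite er // !orbT.
Qed.

End Conversion.

Lemma otree_of_oriented_tree (V : finType) (e : rel V) : oriented_tree e ->
  exists t : otree V, [/\ uniq (leaves t), forall x, x \in leaves t &
    forall x y, e x y -> (x, y) \in edges t].
Proof.
case=> /card_gt0P[r _] irr asym conn acyc.
have [|x _|t [_ ut lt et]] := @tree_of_connected V e irr asym acyc setT r; first by rewrite inE.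
  apply: connect_sub (conn r x) => a b ab; apply: connect1.
  by rewrite /inside ab !inE.
exists t; split=> // [x|x y exy]; first by rewrite lt inE.
by apply: et; rewrite ?inE.
Qed.

Lemma copy_of_universal (V W : finType) (e : rel V) (D : rel W) X : oriented_tree e ->
  universal D X #|V| -> exists f : V -> W, injective f /\ forall x y, e x y -> D (f x) (f y).
Proof.
move=> /otree_of_oriented_tree[t [ut lt et]] univ.
have sz : osize t <= #|V| by rewrite -size_leaves -(card_uniqP ut) max_card.
have [v [U [em _]]] := universal_tree univ sz.
have [f [f1 _ _ f4]] := emb_fun ut em; exists f; split=> [x y|x y /et /f4 //].
by apply: f1; apply: lt.
Qed.

(** Since [dual] reverses edges, red copies of [S] correspond to copies of the reversed tree in
    [dual D]. *)
Lemma oriented_tree_conv (V : finType) (e : rel V) : oriented_tree e -> oriented_tree (conv e).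
Proof.
have uE : undirected (conv e) =2 undirected e by move=> x y; rewrite /undirected orbC.
case=> V0 irr asym conn acyc; split=> //.
- by move=> x y; apply: asym.
- by move=> x y; rewrite (eq_connect uE); apply: conn.
- by move=> s us s2; rewrite (eq_cycle uE); apply: acyc.
Qed.

Theorem mainTheorem16 :
  exists c : nat,
    forall (VS VT : finType) (eS : rel VS) (eT : rel VT),
      oriented_tree eS -> oriented_tree eT ->
      ramsey_le eS eT (c * (#|VS| + #|VT|)).
Proof.
have [c bound] := tree_tree; exists c.+1 => VS VT eS eT treeS treeT.
exists (c.+1 * (#|VS| + #|VT|)) => // col.
pose D : rel 'I_(c.+1 * (#|VS| + #|VT|)) := fun x y => ~~ col x y.
have [leT|ltT] := leqP #|VT| (unum D setT).
  right; have [f [fi fe]] := copy_of_universal treeT (universal_le leT (@universal_unum _ D setT)).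
  by exists f; split=> // x y /fe; rewrite /D => /negPf.
have [leS|ltS] := leqP #|VS| (unum (dual D) setT).
  left; have [f [fi fe]] := copy_of_universal (oriented_tree_conv treeS)
    (universal_le leS (@universal_unum _ (dual D) setT)).
  by exists f; split=> // x y exy; have := fe y x exy; rewrite /dual /D negbK.
(* Both universality numbers are now too small: the factor [c + 1] in the number of vertices makes
   the bound strict, [S] being nonempty. *)
have := bound _ D setT; rewrite cardsT card_ord leqNgt => /negP[].
apply: leq_ltn_trans (_ : c * (#|VS| + #|VT|) < _).
  by rewrite leq_mul2l (leq_trans (leq_add (ltnW ltT) (ltnW ltS))) ?orbT // addnC.
by rewrite ltn_pmul2r // addn_gt0; case: treeS => ->.
Qed.
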